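(* Let $\varphi:\mathbb{R}^n\to\mathbb{R}$ be of class $\mathcal C^{1,1}$ on a neighborhood of its tilt-stable local minimizer $\bar x$ with modulus $\kappa>0$, and let $\nabla\varphi$ be semismooth$^*$ at $\bar x$. Then there is $\delta>0$ such that for any starting point $x_0\in\mathbb B_\delta(\bar x)$, every sequence $\{x_k\}$ generated by the following algorithm (Algorithm A) is well-defined (the sets $\Upsilon^*(x_k)$ are nonempty) and, if infinite, converges to $\bar x$ Q-superlinearly, i.e. $\|x_{k+1}-\bar x\|=o(\|x_k-\bar x\|)$. Algorithm A: given $x_k$, if $\nabla\varphi(x_k)=0$ stop; otherwise select $d_k\in\Upsilon^*(x_k)$ and set $x_{k+1}:=x_k-d_k$, where $\Upsilon^*(x):=\{y: -\nabla\varphi(x)\in D^*\nabla\varphi(x)(-y)\}$.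
   Context: $\mathcal C^{1,1}$ near $\bar x$: differentiable with locally Lipschitz gradient near $\bar x$. Regular normal cone $\widehat N_\Omega(\bar x)=\{v:\limsup_{x\to\bar x,x\in\Omega}\langle v,x-\bar x\rangle/\|x-\bar x\|\le0\}$; limiting normal cone $N_\Omega(\bar x)$ = all limits of $v_k\in\widehat N_\Omega(x_k)$, $x_k\to\bar x$, $x_k\in\Omega$. For $F:\mathbb{R}^n\rightrightarrows\mathbb{R}^m$, $D^*F(\bar x,\bar y)(v)=\{u:(u,-v)\in N_{\operatorname{gph}F}(\bar x,\bar y)\}$ (for single-valued $f$, $D^*f(x)$). Directional normal cone $N_{\operatorname{gph}F}((\bar x,\bar y);(u,v))$ = all limits of $a_k\in\widehat N_{\operatorname{gph}F}((\bar x,\bar y)+t_k(u_k,v_k))$, $t_k\downarrow0$, $(u_k,v_k)\to(u,v)$; directional coderivative $D^*F((\bar x,\bar y);(u,v))(w)=\{q:(q,-w)\in N_{\operatorname{gph}F}((\bar x,\bar y);(u,v))\}$; $F$ is semismooth$^*$ at $(\bar x,\bar y)$ if for all $(u,v)$, $\langle u^*,u\rangle=\langle v^*,v\rangle$ whenever $u^*\in D^*F((\bar x,\bar y);(u,v))(v^* )$ (for single-valued $f$: at $(\bar x,f(\bar x))$). $\bar x$ is a tilt-stable local minimizer of $\varphi$ with modulus $\kappa>0$ if for some $\gamma>0$ the mapping $M_\gamma(v)=\operatorname{argmin}\{\varphi(x)-\langle v,x\rangle:x\in\mathbb B_\gamma(\bar x)\}$ is single-valued and Lipschitz continuous with constant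 $\kappa$ on a neighborhood of $0$, with $M_\gamma(0)=\{\bar x\}$. *)

(* Defs.v *)
From HB Require Import structures.
From mathcomp Require Import all_boot all_order all_algebra.
From mathcomp Require Import reals.
Set Implicit Arguments. Unset Strict Implicit. Unset Printing Implicit Defensive.
Import Order.TTheory GRing.Theory Num.Theory.
Local Open Scope ring_scope.

Section VarAnal.
Variables (R : realType) (n : nat).
Notation vec := 'rV[R]_n.

Definition dotv (u v : vec) : R := \sum_(i < n) u 0 i * v 0 i.
Definition normv (u : vec) : R := Num.sqrt (dotv u u).

Definition dotp (a b : vec * vec) : R := dotv a.1 b.1 + dotv a.2 b.2.
Definition normp (a : vec * vec) : R := Num.sqrt (dotp a a).
Definition addp (a b : vec * vec) : vec * vec := (a.1 + b.1, a.2 + b.2).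
Definition subp (a b : vec * vec) : vec * vec := (a.1 - b.1, a.2 - b.2).
Definition scalep (t : R) (a : vec * vec) : vec * vec := (t *: a.1, t *: a.2).

Definition cvgp (z : nat -> vec * vec) (l : vec * vec) : Prop :=
  forall e : R, 0 < e -> exists N : nat, forall k, (N <= k)%N -> normp (subp (z k) l) < e.
Definition cvgv (x : nat -> vec) (l : vec) : Prop :=
  forall e : R, 0 < e -> exists N : nat, forall k, (N <= k)%N -> normv (x k - l) < e.
Definition cvgr (t : nat -> R) (l : R) : Prop :=
  forall e : R, 0 < e -> exists N : nat, forall k, (N <= k)%N -> `|t k - l| < e.

(* regular (Frechet) normal cone to Om at zb (empty if zb \notin Om):
   limsup_{z -> zb, z in Om} <v, z - zb>/||z - zb|| <= 0 *)
Definition reg_normal (Om : vec * vec -> Prop) (zb : vec * vec) (v : vec * vec) : Prop :=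
  Om zb /\
  forall e : R, 0 < e -> exists rho : R, 0 < rho /\
    forall z, Om z -> 0 < normp (subp z zb) -> normp (subp z zb) < rho ->
      dotp v (subp z zb) <= e * normp (subp z zb).

Definition lim_normal (Om : vec * vec -> Prop) (zb : vec * vec) (v : vec * vec) : Prop :=
  exists (z vs : nat -> vec * vec),
    (forall k, Om (z k)) /\ cvgp z zb /\ cvgp vs v /\
    (forall k, reg_normal Om (z k) (vs k)).

Definition dir_normal (Om : vec * vec -> Prop) (zb w : vec * vec) (a : vec * vec) : Prop :=
  exists (t : nat -> R) (ws as_ : nat -> vec * vec),
    (forall k, 0 < t k) /\ cvgr t 0 /\ cvgp ws w /\ cvgp as_ a /\
    (forall k, reg_normal Om (addp zb (scalep (t k) (ws k))) (as_ k)).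

Definition gph (g : vec -> vec) : vec * vec -> Prop := fun z => z.2 = g z.1.

Definition coderiv (g : vec -> vec) (x w q : vec) : Prop :=
  lim_normal (gph g) (x, g x) (q, - w).

Definition dir_coderiv (g : vec -> vec) (x u v w q : vec) : Prop :=
  dir_normal (gph g) (x, g x) (u, v) (q, - w).

Definition semismooth_star (g : vec -> vec) (x : vec) : Prop :=
  forall u v us vs : vec, dir_coderiv g x u v vs us -> dotv us u = dotv vs v.

Definition Upsilon_star (g : vec -> vec) (x y : vec) : Prop :=
  coderiv g x (- y) (- g x).

Definition has_gradient (phi : vec -> R) (x gx : vec) : Prop :=
  forall e : R, 0 < e -> exists eta : R, 0 < eta /\
    forall y, normv (y - x) < eta ->
      `|phi y - phi x - dotv gx (y - x)| <= e * normv (y - x).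

Definition C11_near (phi : vec -> R) (g : vec -> vec) (xb : vec) : Prop :=
  exists r L : R, 0 < r /\ 0 <= L /\
    (forall x, normv (x - xb) < r -> has_gradient phi x (g x)) /\
    (forall x y, normv (x - xb) < r -> normv (y - xb) < r ->
       normv (g x - g y) <= L * normv (x - y)).

Definition Mtilt (phi : vec -> R) (xb : vec) (gamma : R) (v x : vec) : Prop :=
  normv (x - xb) <= gamma /\
  forall y, normv (y - xb) <= gamma -> phi x - dotv v x <= phi y - dotv v y.

Definition tilt_stable (phi : vec -> R) (xb : vec) (kappa : R) : Prop :=
  exists gamma : R, 0 < gamma /\
    (forall x, Mtilt phi xb gamma 0 x <-> x = xb) /\
    exists rho : R, 0 < rho /\
      (forall v, normv v < rho -> exists x, Mtilt phi xb gamma v x /\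
                   forall x', Mtilt phi xb gamma v x' -> x' = x) /\
      (forall v1 v2 x1 x2, normv v1 < rho -> normv v2 < rho ->
         Mtilt phi xb gamma v1 x1 -> Mtilt phi xb gamma v2 x2 ->
         normv (x1 - x2) <= kappa * normv (v1 - v2)).

Definition algA_run (g : vec -> vec) (x : nat -> vec) (k : nat) : Prop :=
  forall j, (j < k)%N -> g (x j) <> 0 /\ Upsilon_star g (x j) (x j - x j.+1).

End VarAnal.

(* Main.v *)
Require Import Defs.
From HB Require Import structures.
From mathcomp Require Import all_boot all_order all_algebra.
From mathcomp Require Import reals.
From mathcomp Require Import boolp classical_sets topology normedtype sequences derive.
From mathcomp Require Import ring lra.
Import Order.TTheory GRing.Theory Num.Theory.
Import numFieldNormedType.Exports.
Local Open Scope ring_scope.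

(* Write h = x - xb, G h = g (xb + h) and Phi h = phi (xb + h).  Tilt stability
   makes g strongly monotone near xb: the conjugate of phi has the Lipschitz
   solution map M as its gradient, which gives a uniform quadratic growth
   condition and M (g x) = x near xb.  Strong monotonicity provides an element
   of the set Upsilon_star by minimizing <g x, y> + K |g y - g x|^2 over y and
   letting K go to infinity.

   If G were twice differentiable at h with (symmetric) Hessian A, then
   d in Upsilon_star would solve A d = G h, semismoothness* would give
   A h = G h + o(|h|), and positive definiteness of A would yield
   h - d = o(|h|).  No second derivatives are needed: semismoothness* says that
   G is almost positively homogeneous along rays, hence the Euler defect
   E h = <h, G h> - 2 Phi h, whose formal gradient is A h - G h, has Lipschitz
   constant o(|h|) near h.  This controls <h, G (h + t k) - G h>, which is
   where the symmetry of the Hessian enters, and the argument above goes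
   through for any regular normal to the graph of g at points near xb. *)

(** * Euclidean geometry of vectors and of pairs of vectors *)

Section Euclidean.
Context {R : realType} {n : nat}.
Implicit Types (x y z : 'rV[R]_n) (a b p q : 'rV[R]_n * 'rV[R]_n) (t : R).

Lemma dotvC x y : dotv x y = dotv y x.
Proof. by apply: eq_bigr => i _; rewrite mulrC. Qed.

Lemma dotvDl x y z : dotv (x + y) z = dotv x z + dotv y z.
Proof. by rewrite -big_split; apply: eq_bigr => i _; rewrite mxE mulrDl. Qed.

Lemma dotvZl t x y : dotv (t *: x) y = t * dotv x y.
Proof. by rewrite /dotv mulr_sumr; apply: eq_bigr => i _; rewrite mxE mulrA. Qed.

Lemma dotvDr x y z : dotv z (x + y) = dotv z x + dotv z y.
Proof. by rewrite dotvC dotvDl !(dotvC z). Qed.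

Lemma dotvZr t x y : dotv x (t *: y) = t * dotv x y.
Proof. by rewrite dotvC dotvZl dotvC. Qed.

Lemma dotvNl x y : dotv (- x) y = - dotv x y.
Proof. by rewrite -scaleN1r dotvZl mulN1r. Qed.

Lemma dotvNr x y : dotv x (- y) = - dotv x y.
Proof. by rewrite dotvC dotvNl dotvC. Qed.

Lemma dotv0l x : dotv 0 x = 0.
Proof. by rewrite -(scale0r x) dotvZl mul0r. Qed.

Lemma dotv0r x : dotv x 0 = 0.
Proof. by rewrite dotvC dotv0l. Qed.

Definition dotvE := (dotvDl, dotvDr, dotvNl, dotvNr, dotvZl, dotvZr, dotv0l, dotv0r).

Lemma dotvv_ge0 x : 0 <= dotv x x.
Proof. by apply: sumr_ge0 => i _; rewrite -expr2 sqr_ge0. Qed.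

Lemma normv_ge0 x : 0 <= normv x.
Proof. exact: sqrtr_ge0. Qed.

Lemma sqr_normv x : normv x ^+ 2 = dotv x x.
Proof. by rewrite sqr_sqrtr ?dotvv_ge0. Qed.

Lemma coord_le_normv x i : `|x 0 i| <= normv x.
Proof.
rewrite -sqrtr_sqr ler_wsqrtr // /dotv (bigD1 i) //= -expr2 lerDl.
by apply: sumr_ge0 => j _; rewrite -expr2 sqr_ge0.
Qed.

Lemma normv0 : normv (0 : 'rV[R]_n) = 0.
Proof. by rewrite /normv dotv0l sqrtr0. Qed.

Lemma normv_eq0 x : normv x = 0 -> x = 0.
Proof.
move=> x0; apply/rowP => i; rewrite mxE; apply/eqP; rewrite -normr_eq0.
by rewrite eq_le normr_ge0 -x0 coord_le_normv.
Qed.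

Lemma normv_gt0 x : x <> 0 -> 0 < normv x.
Proof.
by move=> x0; rewrite lt_neqAle normv_ge0 andbT eq_sym; apply/eqP => /normv_eq0.
Qed.

Lemma normvZ t x : normv (t *: x) = `|t| * normv x.
Proof.
by rewrite /normv dotvZl dotvZr mulrA -expr2 sqrtrM ?sqr_ge0 // sqrtr_sqr.
Qed.

Lemma normvN x : normv (- x) = normv x.
Proof. by rewrite -scaleN1r normvZ normrN1 mul1r. Qed.

Lemma normvBC x y : normv (x - y) = normv (y - x).
Proof. by rewrite -normvN opprB. Qed.

Lemma dotv_le x y : dotv x y <= normv x * normv y.
Proof.
have [->|/eqP/normv_gt0 x0] := eqVneq x 0; first by rewrite dotv0l normv0 mul0r.
have [->|/eqP/normv_gt0 y0] := eqVneq y 0; first by rewrite dotv0r normv0 mulr0.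
have := dotvv_ge0 (normv y *: x - normv x *: y).
rewrite !dotvE (dotvC y x) -!sqr_normv => h.
rewrite -subr_ge0 -(pmulr_rge0 _ (mulr_gt0 x0 y0)); lra.
Qed.

Lemma normr_dotv_le x y : `|dotv x y| <= normv x * normv y.
Proof.
by rewrite ler_norml dotv_le andbT lerNl -dotvNl -(normvN x) dotv_le.
Qed.

Lemma normvD x y : normv (x + y) <= normv x + normv y.
Proof.
rewrite -(@ler_pXn2r _ 2) ?nnegrE ?addr_ge0 ?normv_ge0 //.
rewrite sqr_normv !dotvE (dotvC y x) -!sqr_normv.
have := dotv_le x y; lra.
Qed.

Lemma normvB x y : normv (x - y) <= normv x + normv y.
Proof. by rewrite -(normvN y) normvD. Qed.

Lemma normv_le_sum x : normv x <= \sum_i `|x 0 i|.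
Proof.
rewrite -(@ler_pXn2r _ 2) ?nnegrE ?normv_ge0 ?sumr_ge0 //.
rewrite sqr_normv expr2 mulr_suml ler_sum // => i _.
rewrite (bigD1 i) //= mulrDr -normrM ler_wpDr //.
  by rewrite mulr_ge0 ?sumr_ge0.
exact: ler_norm.
Qed.

Lemma dotpp_ge0 a : 0 <= dotp a a.
Proof. by rewrite addr_ge0 ?dotvv_ge0. Qed.

Lemma normp_ge0 a : 0 <= normp a.
Proof. exact: sqrtr_ge0. Qed.

Lemma sqr_normp a : normp a ^+ 2 = normv a.1 ^+ 2 + normv a.2 ^+ 2.
Proof. by rewrite sqr_sqrtr ?dotpp_ge0 // !sqr_normv. Qed.

Lemma normv1_le_normp a : normv a.1 <= normp a.
Proof.
rewrite -(@ler_pXn2r _ 2) ?nnegrE ?normp_ge0 ?normv_ge0 // sqr_normp.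
by rewrite lerDl sqr_ge0.
Qed.

Lemma normv2_le_normp a : normv a.2 <= normp a.
Proof.
rewrite -(@ler_pXn2r _ 2) ?nnegrE ?normp_ge0 ?normv_ge0 // sqr_normp.
by rewrite lerDr sqr_ge0.
Qed.

Lemma normp_le a : normp a <= normv a.1 + normv a.2.
Proof.
rewrite -(@ler_pXn2r _ 2) ?nnegrE ?addr_ge0 ?normp_ge0 ?normv_ge0 // sqr_normp.
have := normv_ge0 a.1; have := normv_ge0 a.2; nra.
Qed.

End Euclidean.

(** * Limits of sequences and extraction of convergent subsequences *)

Section Sequences.
Context {R : realType} {n : nat}.

Lemma cvgp_pair (u v : nat -> 'rV[R]_n) (a b : 'rV[R]_n) :
  cvgv u a -> cvgv v b -> cvgp (fun k => (u k, v k)) (a, b).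
Proof.
move=> ua vb e e0; have e2 : 0 < e / 2 by rewrite divr_gt0.
have [M Mu] := ua _ e2; have [N Nv] := vb _ e2.
exists (maxn M N) => k; rewrite geq_max => /andP[/Mu uk /Nv vk].
apply: le_lt_trans (normp_le _) _ => /=; lra.
Qed.

Lemma cvgp_fst (z : nat -> 'rV[R]_n * 'rV[R]_n) l :
  cvgp z l -> cvgv (fun k => (z k).1) l.1.
Proof.
move=> zl e /zl[N zN]; exists N => k /zN; apply: le_lt_trans.
exact: (normv1_le_normp (subp (z k) l)).
Qed.

Lemma cvgp_snd (z : nat -> 'rV[R]_n * 'rV[R]_n) l :
  cvgp z l -> cvgv (fun k => (z k).2) l.2.
Proof.
move=> zl e /zl[N zN]; exists N => k /zN; apply: le_lt_trans.
exact: (normv2_le_normp (subp (z k) l)).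
Qed.

Lemma cvgvN (u : nat -> 'rV[R]_n) a : cvgv u a -> cvgv (fun k => - u k) (- a).
Proof.
by move=> ua e /ua[N uN]; exists N => k /uN; rewrite -opprD normvN.
Qed.

Lemma cvgv_cst (a : 'rV[R]_n) : cvgv (fun=> a) a.
Proof. by move=> e e0; exists 0%N => k _; rewrite subrr normv0. Qed.

(** Extractions are encoded as index maps with [k <= f k]: this bound preserves limits and survives
    composition. *)
Lemma cvgv_sub (u : nat -> 'rV[R]_n) a (f : nat -> nat) :
  (forall k, (k <= f k)%N) -> cvgv u a -> cvgv (u \o f) a.
Proof.
by move=> fk ua e /ua[N uN]; exists N => k Nk; apply/uN/(leq_trans Nk).
Qed.

Lemma cvgr_sub (u : nat -> R) a (f : nat -> nat) :
  (forall k, (k <= f k)%N) -> cvgr u a -> cvgr (u \o f) a.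
Proof.
by move=> fk ua e /ua[N uN]; exists N => k Nk; apply/uN/(leq_trans Nk).
Qed.

Lemma increasing_seq_ge (f : nat -> nat) :
  increasing_seq f -> forall k, (k <= f k)%N.
Proof.
move=> /increasing_seqP fi; elim=> // k ih; exact: leq_ltn_trans ih (fi k).
Qed.

Lemma bounded_cvgr (u : nat -> R) (C : R) : (forall k, `|u k| <= C) ->
  exists (f : nat -> nat) (l : R), (forall k, (k <= f k)%N) /\ cvgr (u \o f) l.
Proof.
move=> uC; have : bounded_fun u.
  exists C; split; first exact: num_real.
  by move=> M CM k _ /=; rewrite (le_trans (uC k)) // ltW.
move=> /bolzano_weierstrass[f fi /cvg_ex[l fl]].
exists f, l; split; first exact: increasing_seq_ge.
move=> e e0; have := fl; move/cvgrPdist_lt => /(_ e e0)[N _ fN].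
by exists N => k /fN /=; rewrite distrC.
Qed.

Lemma bounded_cvgv (u : nat -> 'rV[R]_n) (C : R) : (forall k, normv (u k) <= C) ->
  exists (f : nat -> nat) (l : 'rV[R]_n), (forall k, (k <= f k)%N) /\ cvgv (u \o f) l.
Proof.
move=> uC.
(* Coordinates are treated one at a time: [m] counts those that already converge, and a further
   extraction keeps their limits. *)
have /(_ n)[f [l [fk fl]]] : forall m, exists (f : nat -> nat) (l : 'rV[R]_n),
    (forall k, (k <= f k)%N) /\
    forall i : 'I_n, (i < m)%N -> cvgr (fun k => u (f k) 0 i) (l 0 i).
  elim=> [|m [f [l [fk fl]]]]; first by exists id, 0.
  have [mn|nm] := ltnP m n; last first.
    by exists f, l; split=> // i _; apply/fl/leq_trans/nm.
  pose j := Ordinal mn.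
  have [k|h [c [hk hc]]] := @bounded_cvgr (fun k => u (f k) 0 j) C.
    exact: le_trans (coord_le_normv _ _) (uC _).
  exists (f \o h), (\row_i if i == j then c else l 0 i); split.
    by move=> k; exact: leq_trans (hk k) (fk _).
  move=> i im; rewrite mxE; case: eqVneq => [->|ij]; first exact: hc.
  apply: (@cvgr_sub (fun k => u (f k) 0 i)) => //; apply: fl.
  by rewrite ltn_neqAle -ltnS im andbT.
exists f, l; split=> // e e0.
(* [n.+1] rather than [n] covers dimension 0 and makes the sum of [n] errors strictly less than
   [e]. *)
have e1 : 0 < e / n.+1%:R by rewrite divr_gt0.
have /choice[N fN] : forall i : 'I_n, exists N, forall k, (N <= k)%N ->
    `|u (f k) 0 i - l 0 i| < e / n.+1%:R.
  by move=> i; apply: fl.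
exists (\max_i N i) => k Nk; apply: le_lt_trans (normv_le_sum _) _.
apply: (@le_lt_trans _ _ (\sum_(i < n) e / n.+1%:R)).
  apply: ler_sum => i _; rewrite !mxE ltW // fN //.
  by apply: leq_trans Nk; exact: leq_bigmax.
rewrite sumr_const card_ord -[ltLHS]mulr_natr -mulrA gtr_pMr //.
by rewrite mulrC ltr_pdivrMr ?mul1r ?ltr_nat.
Qed.

Lemma cvgr_dotv (u v : nat -> 'rV[R]_n) a b :
  cvgv u a -> cvgv v b -> cvgr (fun k => dotv (u k) (v k)) (dotv a b).
Proof.
move=> ua vb e e0.
set A := normv a + normv b + 1.
have A0 : 0 < A by rewrite ltr_wpDl ?addr_ge0 ?normv_ge0.
(* Since [d <= 1], the product of the two errors is bounded by [d], and the three terms add up to at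
   most [d * A]. *)
pose d := Num.min 1 (e / (2 * A)).
have d0 : 0 < d by rewrite lt_min ltr01 divr_gt0 ?mulr_gt0.
have [M Mu] := ua _ d0; have [N Nv] := vb _ d0.
exists (maxn M N) => k; rewrite geq_max => /andP[/Mu uk /Nv vk].
have -> : dotv (u k) (v k) - dotv a b =
    dotv (u k - a) (v k - b) + dotv a (v k - b) + dotv (u k - a) b.
  rewrite !dotvE; ring.
have dA : d * A <= e / 2.
  by rewrite -ler_pdivlMr // -mulrA -invfM ge_min lexx orbT.
have d1 : d <= 1 by rewrite ge_min lexx.
apply: le_lt_trans (ler_normD _ _) _.
apply: le_lt_trans (lerD (ler_normD _ _) (lexx _)) _.
have := normr_dotv_le (u k - a) (v k - b).
have := normr_dotv_le a (v k - b).
have := normr_dotv_le (u k - a) b.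
have := normv_ge0 a; have := normv_ge0 b.
have := normv_ge0 (u k - a); have := normv_ge0 (v k - b).
move: dA; rewrite /A => dA; nra.
Qed.

End Sequences.

(** * Existence of minimizers *)

Section Minimization.
Context {R : realType}.

Lemma archi_inv (e : R) : 0 < e -> exists N : nat, forall k, (N <= k)%N -> k.+1%:R^-1 < e.
Proof.
move=> e0; exists (Num.bound e^-1) => k Nk.
rewrite -(invrK e) ltf_pV2 ?posrE ?invr_gt0 //.
apply: lt_le_trans (archi_boundP _) _; first by rewrite invr_ge0 ltW.
by rewrite ler_nat leqW.
Qed.

Lemma cvgr_le (u : nat -> R) l b : cvgr u l -> (forall k, u k <= b) -> l <= b.
Proof.
move=> ul ub; rewrite leNgt; apply/negP => bl.
have [N /(_ N (leqnn N))] := ul (l - b) ltac:(lra).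
by have := ub N; rewrite ltr_norml; lra.
Qed.

Lemma cvgr_ge (u : nat -> R) l b : cvgr u l -> (forall k, b <= u k) -> b <= l.
Proof.
move=> ul ub; rewrite leNgt; apply/negP => bl.
have [N /(_ N (leqnn N))] := ul (b - l) ltac:(lra).
by have := ub N; rewrite ltr_norml; lra.
Qed.

Lemma cvgv_dist_le {n} (u : nat -> 'rV[R]_n) l c (b : R) :
  cvgv u l -> (forall k, normv (u k - c) <= b) -> normv (l - c) <= b.
Proof.
move=> ul ub; rewrite leNgt; apply/negP => bl.
have [N /(_ N (leqnn N))] := ul (normv (l - c) - b) ltac:(lra).
have := normvD (l - u N) (u N - c).
rewrite addrA subrK (normvBC l); have := ub N; lra.
Qed.

(** Direct method. The hypothesis bundles sequential compactness with lower semicontinuity along the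
    extracted sequence; it is applied once to bound [F] below and once to a minimizing sequence. *)
Lemma min_of_seq_compact {T} (S : T -> Prop) (F : T -> R) (p0 : T) : S p0 ->
  (forall u : nat -> T, (forall k, S (u k)) ->
     exists (f : nat -> nat) (l : T), (forall k, (k <= f k)%N) /\ S l /\
       forall e : R, 0 < e ->
         exists N : nat, forall k, (N <= k)%N -> F l <= F (u (f k)) + e) ->
  exists2 p, S p & forall p', S p' -> F p <= F p'.
Proof.
move=> Sp0 cpt.
have [B FB] : exists B, forall p, S p -> B <= F p.
  apply: contrapT => /forallNP nB.
  have /choice[u uP] : forall k : nat, exists p, S p /\ F p < - k%:R.
    move=> k; have := nB (- k%:R); move/existsNP => [p /not_implyP[Sp /negP]].
    by rewrite -ltNge => Fp; exists p.
  have [f [l [fk [_ /(_ 1 ltr01)[N FN]]]]] := cpt u (fun k => (uP k).1).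
  pose M := maxn N (Num.bound `|1 - F l|).
  have bM : (Num.bound `|1 - F l|)%:R <= (f M)%:R :> R.
    by rewrite ler_nat (leq_trans _ (fk _)) // leq_maxr.
  have := FN M (leq_maxl _ _); have := (uP (f M)).2.
  have := archi_boundP (normr_ge0 (1 - F l)); have := ler_norm (1 - F l); lra.
pose E : set R := [set F p | p in S]%classic.
have hE : has_inf E.
  by split; [exists (F p0), p0|exists B => _ [p Sp <-]; exact: FB].
have /choice[u uP] : forall k : nat, exists p, S p /\ F p < inf E + k.+1%:R^-1.
  move=> k; have [|_ [p Sp <-] Fp] := @inf_adherent _ E k.+1%:R^-1 _ hE.
    by rewrite invr_gt0.
  by exists p.
have [f [l [fk [Sl Fl]]]] := cpt u (fun k => (uP k).1).
exists l => // p Sp.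
apply: (@le_trans _ _ (inf E)); last first.
  by apply: ge_inf; [exact: hE.2|exists p].
apply/ler_addgt0Pr => e e0.
have e2 : 0 < e / 2 by rewrite divr_gt0.
have [N FN] := Fl _ e2; have [M eM] := archi_inv _ e2.
have := FN (maxn N M) (leq_maxl _ _).
have := (uP (f (maxn N M))).2.
have := eM (f (maxn N M)) (leq_trans (leq_maxr _ _) (fk _)).
move: (f (maxn N M)) => k; move: (inf E) => m; move: (k.+1%:R^-1) => t; lra.
Qed.

(** Lipschitz continuity supplies the lower semicontinuity. The extra real variable serves penalized
    problems in which the position along a ray is optimized too. *)
Lemma min_ball_segment {n} (c : 'rV[R]_n) (rho a b C : R) (F : 'rV[R]_n -> R -> R) :
  0 <= rho -> a <= b ->
  (forall z s z' s', normv (z - c) <= rho -> normv (z' - c) <= rho ->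
     a <= s <= b -> a <= s' <= b ->
     F z s <= F z' s' + C * (normv (z - z') + `|s - s'|)) ->
  exists z s, [/\ normv (z - c) <= rho, a <= s <= b &
    forall z' s', normv (z' - c) <= rho -> a <= s' <= b -> F z s <= F z' s'].
Proof.
move=> rho0 ab FC.
have [|u uS|[z s] [/= zc sab] zmin] := @min_of_seq_compact _
  (fun p : 'rV[R]_n * R => normv (p.1 - c) <= rho /\ a <= p.2 <= b)
  (fun p => F p.1 p.2) (c, a).
- by rewrite /= subrr normv0 lexx.
- have [k|f [z [fk fz]]] := @bounded_cvgv _ _ (fun k => (u k).1) (rho + normv c).
    rewrite -(subrK c (u k).1); apply: le_trans (normvD _ _) _.
    by rewrite lerD2r; exact: (uS k).1.
  have [k|h [s [hk hs]]] := @bounded_cvgr _ (fun k => (u (f k)).2) (`|a| + `|b|).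
    have /andP[] := (uS (f k)).2; have := ler_norm b; have := ler_norm (- a).
    by rewrite normrN ler_norml; have := normr_ge0 a; have := normr_ge0 b; lra.
  have hz : cvgv (fun k => (u (f (h k))).1) z.
    by apply: (@cvgv_sub _ _ (fun k => (u (f k)).1)).
  have zc : normv (z - c) <= rho.
    by apply: (cvgv_dist_le _ _ _ _ hz) => k; exact: (uS _).1.
  have sab : a <= s <= b.
    by apply/andP; split; [apply: (cvgr_ge _ _ _ hs)|apply: (cvgr_le _ _ _ hs)] => k;
      have /andP[] := (uS (f (h k))).2.
  exists (f \o h), (z, s); split; first by move=> k; exact: leq_trans (hk k) (fk _).
  split=> // e e0.
  have C0 : 0 < `|C| + 1 by rewrite ltr_wpDl.
  have d0 : 0 < e / (2 * (`|C| + 1)) by rewrite divr_gt0 ?mulr_gt0.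
  have [N zN] := hz _ d0; have [M sM] := hs _ d0.
  exists (maxn N M) => k; rewrite geq_max => /andP[/zN zk /sM sk].
  apply: le_trans (FC _ _ _ _ zc (uS (f (h k))).1 sab (uS (f (h k))).2) _.
  rewrite lerD2l normvBC distrC.
  set t := _ + _.
  have t0 : 0 <= t by rewrite addr_ge0 ?normv_ge0.
  have : t < e / (`|C| + 1).
    have -> : e / (`|C| + 1) = e / (2 * (`|C| + 1)) + e / (2 * (`|C| + 1)) by field; lra.
    exact: ltrD zk sk.
  rewrite ltr_pdivlMr // => te.
  have := ler_norm C; nra.
by exists z, s; split=> // z' s' *; exact: (zmin (z', s')).
Qed.

Lemma min_ball {n} (c : 'rV[R]_n) (rho C : R) (F : 'rV[R]_n -> R) : 0 <= rho ->
  (forall z z', normv (z - c) <= rho -> normv (z' - c) <= rho ->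
     F z <= F z' + C * normv (z - z')) ->
  exists2 z, normv (z - c) <= rho & forall z', normv (z' - c) <= rho -> F z <= F z'.
Proof.
move=> rho0 FC.
have [z s z' s' zc zc' s0 s0'|z [s [zc _ zmin]]] :=
    @min_ball_segment _ c rho 0 0 `|C| (fun z _ => F z) rho0 (lexx _).
  apply: le_trans (FC _ _ zc zc') _; rewrite lerD2l.
  rewrite (le_trans (ler_wpM2r (normv_ge0 _) (ler_norm C))) //.
  by rewrite ler_wpM2l // lerDl.
by exists z => // z' zc'; apply: (zmin z' 0) => //; rewrite lexx.
Qed.

End Minimization.

(** * Regular normals to graphs *)

Section RegularNormals.
Context {R : realType} {n : nat}.
Implicit Types (g : 'rV[R]_n -> 'rV[R]_n) (x y q w xb : 'rV[R]_n).

(** A quadratic error is at most [e] times the distance at distances below [e / (|C| + 1)].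
    Minimality in a quadratically penalized problem yields bounds of this form. *)
Lemma reg_normal_gph_quadratic g y q w (rho C : R) : 0 < rho ->
  (forall x, normv (x - y) < rho -> dotv q (x - y) - dotv w (g x - g y) <=
     C * (normv (x - y) ^+ 2 + normv (g x - g y) ^+ 2)) ->
  reg_normal (gph g) (y, g y) (q, - w).
Proof.
move=> rho0 qC; split=> // e e0.
have C0 : 0 < `|C| + 1 by rewrite ltr_wpDl.
exists (Num.min rho (e / (`|C| + 1))); split; first by rewrite lt_min rho0 divr_gt0.
move=> [x gx]; rewrite /gph /= => -> _.
rewrite lt_min => /andP[xrho]; rewrite ltr_pdivlMr // => xe.
rewrite /dotp /= dotvNl.
apply: le_trans (qC _ (le_lt_trans (normv1_le_normp (subp (x, g x) (y, g y))) xrho)) _.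
have -> : normv (x - y) ^+ 2 + normv (g x - g y) ^+ 2 =
   normp (subp (x, g x) (y, g y)) ^+ 2 by rewrite sqr_normp.
have := normp_ge0 (subp (x, g x) (y, g y)); have := ler_norm C; nra.
Qed.

(** Distances in the graph are at most [1 + L] times those in the domain, so the defining inequality
    can be read in [x] alone. *)
Lemma reg_normal_gph_lipschitz g y q w (rho L : R) : 0 < rho -> 0 <= L ->
  (forall x, normv (x - y) < rho -> normv (g x - g y) <= L * normv (x - y)) ->
  reg_normal (gph g) (y, g y) (q, - w) ->
  forall e : R, 0 < e -> exists2 rho', 0 < rho' & forall x, normv (x - y) < rho' ->
    dotv q (x - y) - dotv w (g x - g y) <= e * normv (x - y).
Proof.
move=> rho0 L0 lip [_ reg] e e0.
have L1 : 0 < 1 + L by lra.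
have [d [d0 dP]] := reg (e / (1 + L)) ltac:(by rewrite divr_gt0).
exists (Num.min rho (d / (1 + L))); first by rewrite lt_min rho0 divr_gt0.
move=> x; rewrite lt_min => /andP[/lip gx]; rewrite ltr_pdivlMr // => xd.
have [->|/eqP xy] := eqVneq x y; first by rewrite !subrr !dotv0r normv0 subrr mulr0.
have xy0 : 0 < normv (x - y) by apply: normv_gt0 => /subr0_eq.
have np := normp_le (subp (x, g x) (y, g y)).
rewrite /= in np.
have := dP (x, g x) erefl (lt_le_trans xy0 (normv1_le_normp (subp (x, g x) (y, g y)))).
rewrite {1}/dotp /= dotvNl => reg'; have {}reg' := reg' (le_lt_trans np _).
apply: le_trans (reg' _) _; first by lra.
 rewrite mulrAC ler_pdivrMr // -mulrA ler_wpM2l ?(ltW e0) //.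
by apply: (le_trans np); lra.
Qed.

End RegularNormals.

(** * Semismoothness*: a uniform estimate and near homogeneity along rays *)

Section Semismooth.
Context {R : realType} {n : nat} (g : 'rV[R]_n -> 'rV[R]_n) (xb : 'rV[R]_n) (r L : R).
Hypotheses (r0 : 0 < r) (L0 : 0 <= L) (gxb : g xb = 0)
  (lip : forall x y, normv (x - xb) < r -> normv (y - xb) < r ->
     normv (g x - g y) <= L * normv (x - y))
  (ss : semismooth_star g xb).

(** Compactness argument: along a sequence of violations, the normals and the directions rescaled by
    the distance to [xb] are bounded, the latter by the Lipschitz property. A common limit is a
    directional normal that contradicts semismoothness*. *)
Lemma semismooth_uniform (Q : R) (e : R) : 0 < e ->
  exists2 delta, 0 < delta & forall y q w, normv (y - xb) < delta ->
    normv w <= 1 -> normv q <= Q -> reg_normal (gph g) (y, g y) (q, - w) ->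
    `|dotv q (y - xb) - dotv w (g y)| <= e * normv (y - xb).
Proof.
move=> e0; apply: contrapT => nex.
have /choice[p pP] : forall k : nat, exists p : 'rV[R]_n * ('rV[R]_n * 'rV[R]_n),
    [/\ normv (p.1 - xb) < Num.min r k.+1%:R^-1, normv p.2.2 <= 1, normv p.2.1 <= Q,
      reg_normal (gph g) (p.1, g p.1) (p.2.1, - p.2.2) &
      e * normv (p.1 - xb) < `|dotv p.2.1 (p.1 - xb) - dotv p.2.2 (g p.1)|].
  move=> k; apply: contrapT => np; apply: nex.
  exists (Num.min r k.+1%:R^-1); first by rewrite lt_min r0 invr_gt0 ltr0n.
  move=> y q w yk w1 qQ reg; rewrite leNgt; apply/negP => lt_e.
  by apply: np; exists (y, (q, w)).
pose t k := normv ((p k).1 - xb).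
(* At [xb] both sides of the violated estimate vanish, so the violating points differ from [xb] and
   can be normalized. *)
have t0 k : 0 < t k.
  rewrite lt_neqAle normv_ge0 andbT eq_sym; apply/eqP => /normv_eq0/subr0_eq pxb.
  have [_ _ _ _] := pP k.
  by rewrite pxb gxb subrr !dotv0r subrr normv0 normr0 mulr0 ltxx.
pose u k := (t k)^-1 *: ((p k).1 - xb); pose v k := (t k)^-1 *: g (p k).1.
have u1 k : normv (u k) <= 1.
  by rewrite normvZ gtr0_norm ?invr_gt0 // mulVf // gt_eqF.
have vL k : normv (v k) <= L.
  rewrite normvZ gtr0_norm ?invr_gt0 // mulrC ler_pdivrMr //.
  have [pr _ _ _ _] := pP k; move: pr; rewrite lt_min => /andP[pr _].
  by have := lip _ xb pr; rewrite gxb subr0; apply; rewrite subrr normv0.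
have [f1 [q [f1k qP]]] := bounded_cvgv (fun k => (p k).2.1) Q
  (fun k => let: And5 _ _ h _ _ := pP k in h).
have [f2 [w [f2k wP]]] := bounded_cvgv (fun k => (p (f1 k)).2.2) 1
  (fun k => let: And5 _ h _ _ _ := pP (f1 k) in h).
have [f3 [a [f3k aP]]] := bounded_cvgv (fun k => u (f1 (f2 k))) 1 (fun=> u1 _).
have [f4 [b [f4k bP]]] := bounded_cvgv (fun k => v (f1 (f2 (f3 k)))) L (fun=> vL _).
pose f k := f1 (f2 (f3 (f4 k))).
have fk k : (k <= f k)%N.
  by apply: leq_trans (f4k k) _; apply: leq_trans (f3k _) _;
    apply: leq_trans (f2k _) (f1k _).
have {}qP : cvgv (fun k => (p (f k)).2.1) q.
  by apply: (cvgv_sub _ _ (fun k => f2 (f3 (f4 k))) _ qP) => k;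
  apply: leq_trans (f4k k) _; apply: leq_trans (f3k _) (f2k _).
have {}wP : cvgv (fun k => (p (f k)).2.2) w.
  by apply: (cvgv_sub _ _ (fun k => f3 (f4 k)) _ wP) => k;
  apply: leq_trans (f4k k) (f3k _).
have {}aP : cvgv (fun k => u (f k)) a by exact: (cvgv_sub _ _ f4 _ aP).
have {}bP : cvgv (fun k => v (f k)) b by exact: bP.
have eqab : dotv q a = dotv w b.
  apply: ss; exists (t \o f), (fun k => (u (f k), v (f k))),
    (fun k => ((p (f k)).2.1, - (p (f k)).2.2)); split; [|split; [|split; [|split]]].
  - by move=> k; exact: t0.
  - apply: (cvgr_sub _ _ _ fk) => d /archi_inv[N dN]; exists N => k /dN kd.
    rewrite subr0 gtr0_norm //; apply: lt_trans kd.
    by have [] := pP k; rewrite lt_min => /andP[_].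
  - exact: cvgp_pair.
  - by apply: cvgp_pair => //; exact: cvgvN.
  - move=> k; have [_ _ _ reg _] := pP (f k).
    rewrite /addp /scalep /= /u /v !scalerA mulfV ?gt_eqF // !scale1r.
    by rewrite addrCA subrr addr0 gxb add0r.
have [N NP] := cvgr_dotv _ _ _ _ qP aP (e / 2) ltac:(lra).
have [M MP] := cvgr_dotv _ _ _ _ wP bP (e / 2) ltac:(lra).
set k := maxn N M.
have := NP k (leq_maxl _ _); have := MP k (leq_maxr _ _).
have [_ _ _ _] := pP (f k).
rewrite !dotvZr eqab.
set A := dotv _ _; set B := dotv _ (g _); set T := t (f k) => lt_e.
have T0 : 0 < T by exact: t0.
have : e < `|T^-1 * A - T^-1 * B|.
  rewrite -mulrBr normrM gtr0_norm ?invr_gt0 // mulrC ltr_pdivlMr //.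
move: (T^-1 * A) (T^-1 * B) => A' B'.
have := ler_distD (dotv w b) A' B'; rewrite (distrC (dotv w b)); lra.
Qed.

Let G h := g (xb + h).

(* A fuzzy mean value theorem along the ray through h: the minimizer of the
   penalized function yields a regular normal at a point near the segment
   [h, (1 + l) h] whose slope in the direction h is too small. *)
Lemma near_homogeneous_dotv (e : R) : 0 < e -> exists delta l0, [/\ 0 < delta, 0 < l0 &
  forall h w l, normv h <= delta -> 0 < l <= l0 -> normv w <= 1 ->
    - (e * l * normv h) <= dotv w (G ((1 + l) *: h)) - (1 + l) * dotv w (G h)].
Proof.
(* [2 * L] will bound the normal [q]; the point found lies within [3 * N] of [xb], so [e / 12] costs
   a quarter of [e * N]. *)
move=> e0; have [d d0 dP] := semismooth_uniform (2 * L) (e / 12) ltac:(lra).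
have L12 : 0 < 12 * (L + 1) by move: L0; lra.
(* The bound on [l] keeps the drift [3 * (l * L * N)] within another quarter of [e * N]. *)
exists (Num.min d r / 4), (Num.min 1 (e / (12 * (L + 1)))); split.
- by rewrite divr_gt0 // lt_min d0.
- by rewrite lt_min ltr01 divr_gt0.
move=> h w l; rewrite ler_pdivlMr // le_min => /andP[hd hr].
rewrite le_min => /and3P[l0 l1]; rewrite ler_pdivlMr //.
move=> le w1.
have [->|/eqP h_neq0] := eqVneq h 0.
  by rewrite scaler0 normv0 mulr0 oppr0 /G addr0 gxb dotv0r mulr0 subr0.
have N0 := normv_gt0 _ h_neq0; set N := normv h in hd hr N0 *.
rewrite leNgt; apply/negP => lt_e.
pose psi z := dotv w (G z); rewrite -/(psi h) -/(psi _) in lt_e.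
have psi_lip z z' : normv z < r -> normv z' < r -> psi z <= psi z' + L * normv (z - z').
  move=> zr z'r; rewrite -lerBlDl /psi -[_ - _](_ : dotv w (G z - G z') = _); last first.
    by rewrite !dotvE.
  have := lip (xb + z) (xb + z').
  rewrite ![xb + _ - xb]addrAC subrr !add0r [xb + z - _](_ : _ = z - z'); last first.
    by rewrite opprD addrACA subrr add0r.
  move=> /(_ zr z'r) Gz; apply: le_trans (dotv_le _ _) _.
  have := normv_ge0 (G z - G z'); rewrite /G; nra.
pose m := e * N; have m0 : 0 < m by exact: mulr_gt0.
(* The penalized function [F] below is smaller at [(0, 1 + l)] than at [(0, 1)] by exactly [gap]. *)
pose gap := - (m * l) - (psi ((1 + l) *: h) - (1 + l) * psi h).
have gap0 : 0 < gap by move: lt_e; rewrite /gap /m; lra.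
pose b := Num.min gap (Num.min (m / 4) N).
have b0 : 0 < b by rewrite !lt_min gap0 N0 divr_gt0.
have bgap : b <= gap by rewrite ge_min lexx.
have bm : b <= m / 4 by rewrite !ge_min lexx orbT.
have bN : b <= N by rewrite !ge_min lexx !orbT.
(* Large enough that the minimizer has both [normv z] and [L * normv z] below [b]. *)
pose K := (L + 1) ^+ 2 / b.
have K0 : 0 < K by rewrite divr_gt0 // exprn_gt0 //; lra.
have Kb : K * b = (L + 1) ^+ 2 by rewrite divfK // gt_eqF.
clearbody K.
have sN s : 1 <= s <= 1 + l -> normv (s *: h) <= 2 * N.
  by move=> s1; rewrite normvZ ger0_norm ?ler_wpM2r ?normv_ge0 //; lra.
have szr s z : 1 <= s <= 1 + l -> normv z <= N -> normv (s *: h + z) < r.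
  move=> /sN s2 zN; have := normvD (s *: h) z; lra.
pose F z s := psi (s *: h + z) - (psi h - m) * s + K * normv z ^+ 2.
have [||z s z' s'|z [s [+ s1 zmin]]] := @min_ball_segment R n 0 N 1 (1 + l)
    (L + L * N + `|psi h - m| + 2 * K * N) F; [lra|lra| |].
  rewrite !subr0 => zN z'N s1 s'1.
  have P1 := psi_lip _ _ (szr _ _ s1 zN) (szr _ _ s'1 z'N).
  have P2 : normv (s *: h + z - (s' *: h + z')) <= `|s - s'| * N + normv (z - z').
    by rewrite opprD addrACA -scalerBl -normvZ normvD.
  have P3 : (psi h - m) * s' - (psi h - m) * s <= `|psi h - m| * `|s - s'|.
    by rewrite -mulrBr (distrC s) -normrM ler_norm.
  have P4 : normv z <= normv z' + normv (z - z') by rewrite addrC -{1}(subrK z' z) normvD.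
  have P5 : normv z ^+ 2 - normv z' ^+ 2 <= 2 * N * normv (z - z').
    have := normv_ge0 z; have := normv_ge0 z'; have := normv_ge0 (z - z'); nra.
  have P6 := ler_wpM2l L0 P2.
  have P7 := ler_wpM2l (ltW K0) P5.
  have P8 : 0 <= `|psi h - m| * normv (z - z') by rewrite mulr_ge0 ?normv_ge0.
  have P9 := mulr_ge0 (mulr_ge0 (ltW K0) (ltW N0)) (normr_ge0 (s - s')).
  have P10 := mulr_ge0 (mulr_ge0 L0 (ltW N0)) (normv_ge0 (z - z')).
  have P11 : 0 <= L * `|s - s'| by rewrite mulr_ge0.
  rewrite /F; lra.
rewrite subr0 => zN.
have {}zmin z' s' : normv z' <= N -> 1 <= s' <= 1 + l -> F z s <= F z' s'.
  by move=> ? ?; apply: zmin => //; rewrite subr0.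
have z_ge0 := normv_ge0 z.
have Kz : K * normv z <= L.
  have [->|/eqP z_neq0] := eqVneq z 0; first by rewrite normv0 mulr0.
  have z0 := normv_gt0 _ z_neq0.
  have N00 : normv (0 : 'rV[R]_n) <= N by rewrite normv0 ltW.
  have := zmin 0 s N00 s1; have := psi_lip _ _ (szr _ _ s1 N00) (szr _ _ s1 zN).
  rewrite /F normv0 opprD addrACA subrr add0r sub0r normvN addr0 => P1 P2.
  rewrite -(ler_pM2r z0); lra.
have zb : normv z < b.
  by rewrite -(ltr_pM2l K0) Kb; apply: le_lt_trans Kz _; nra.
have Lz : L * normv z < b by rewrite -(ltr_pM2l K0) Kb mulrCA; nra.
(* At [s = 1] the value of [F] would exceed [m - gap], its value at [(0, 1 + l)]. *)
have s_gt1 : 1 < s.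
  rewrite lt_neqAle (andP s1).1 andbT; apply/eqP => s_eq1.
  have N00 : normv (0 : 'rV[R]_n) <= N by rewrite normv0 ltW.
  have in1 : 1 <= 1 + l <= 1 + l by lra.
  have in0 : 1 <= (1:R) <= 1 + l by lra.
  have := zmin 0 (1 + l) N00 in1.
  have := psi_lip _ _ (szr 1 0 in0 N00) (szr 1 z in0 zN).
  rewrite /F -s_eq1 normv0 scale1r !addr0 opprD addrA subrr sub0r normvN.
  have : 0 <= K * normv z ^+ 2 by rewrite mulr_ge0 ?sqr_ge0 // ltW.
  move: bgap; rewrite /gap; lra.
pose q := (- 2 * K) *: z.
have qL : normv q <= 2 * L.
  by rewrite normvZ normrM normrN !gtr0_norm // -mulrA ler_pM2l.
pose y := xb + (s *: h + z).
have yxb : y - xb = s *: h + z by rewrite /y addrAC subrr add0r.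
have reg : reg_normal (gph g) (y, g y) (q, - w).
  apply: (@reg_normal_gph_quadratic _ _ _ _ _ _ (N - normv z) K); first lra.
  move=> x xy; pose z' := z + (x - y).
  have xE : xb + (s *: h + z') = x by rewrite /z' /y !addrA addrAC subrr add0r.
  have z'N : normv z' <= N by have := normvD z (x - y); rewrite -/z'; lra.
  have := zmin z' s z'N s1; rewrite /F /psi /G xE -/y.
  have -> : dotv w (g x - g y) = dotv w (g x) - dotv w (g y) by rewrite !dotvE.
  have := mulr_ge0 (ltW K0) (sqr_ge0 (normv (g x - g y))).
  rewrite /z' /q; move: (x - y) => v; rewrite !sqr_normv !dotvE (dotvC v z); lra.
(* Replacing [(z, s)] by [(z + tau *: h, s - tau)] leaves the argument of [psi] unchanged, so only
   smooth terms vary and first-order optimality applies; [1 < s] leaves room for [tau]. *)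
have slope : m <= psi h - dotv q h.
  have -> : dotv q h = - 2 * K * dotv z h by rewrite /q dotvZl.
  rewrite -subr_ge0 leNgt; apply/negP => slope_lt.
  pose be := - (psi h - - 2 * K * dotv z h - m); have be0 : 0 < be by rewrite oppr_gt0.
  pose tau := Num.min (s - 1) (Num.min ((N - normv z) / N) (be / (2 * (K * N ^+ 2)))).
  have KN0 : 0 < 2 * (K * N ^+ 2) by rewrite mulr_gt0 // mulr_gt0 // exprn_gt0.
  have tau0 : 0 < tau by rewrite !lt_min subr_gt0 s_gt1 !divr_gt0 //; lra.
  have tau_s : tau <= s - 1 by rewrite ge_min lexx.
  have tau_N : tau * N <= N - normv z.
    by rewrite -ler_pdivlMr // !ge_min lexx orbT.
  have tau_K : tau * (2 * (K * N ^+ 2)) <= be.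
    by rewrite -ler_pdivlMr // !ge_min lexx !orbT.
  have ztN : normv (z + tau *: h) <= N.
    apply: le_trans (normvD _ _) _; rewrite normvZ gtr0_norm // -/N; lra.
  have st1 : 1 <= s - tau <= 1 + l by move: s1; lra.
  have := zmin _ _ ztN st1; rewrite /F.
  rewrite [(s - tau) *: h + _](_ : _ = s *: h + z); last first.
    by rewrite scalerBl [z + _]addrC addrA subrK.
  rewrite !sqr_normv !dotvE (dotvC h z) -!sqr_normv -/N => ineq.
  have : 0 <= tau * (be * -1 + K * tau * N ^+ 2) by rewrite /be; lra.
  rewrite pmulr_rge0 //; lra.
have yN : normv (y - xb) <= 3 * N.
  by rewrite yxb; have := normvD (s *: h) z; have := sN _ s1; lra.
(* The uniform estimate bounds [dotv q (y - xb) - dotv w (g y)] below by [- m / 4], while the slope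
   bound forces it below [- m / 2]. *)
have := dP y q w ltac:(lra) w1 qL reg; rewrite ler_norml => /andP[+ _].
rewrite yxb -[dotv w (g y)]/(psi (s *: h + z)) dotvDr dotvZr.
have hr' : normv h < r by rewrite -/N; lra.
have P1 := psi_lip _ _ hr' (szr _ _ s1 zN).
have P2 : normv (h - (s *: h + z)) <= l * N + normv z.
  rewrite opprD addrA -{1}(scale1r h) -scalerBl.
  apply: le_trans (normvB _ _) _; rewrite lerD2r normvZ -/N ler_wpM2r ?(ltW N0) //.
  by rewrite ler_norml; move: s1; lra.
have P3 := ler_wpM2l L0 P2.
have P4 : dotv q z <= 0.
  by rewrite dotvZl mulNr mulNr oppr_le0 !mulr_ge0 ?dotvv_ge0 // ltW.
have P5 : (s - 1) * dotv q h <= l * (2 * L * N).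
  have qh : dotv q h <= 2 * L * N.
    by apply: le_trans (dotv_le q h) _; rewrite -/N ler_wpM2r // ltW.
  move: s1 s_gt1; have : 0 <= 2 * L * N by rewrite !mulr_ge0 // ltW.
  nra.
have P6 : normv (s *: h + z) <= 3 * N by rewrite -yxb.
have P7 := ler_wpM2l (ltW e0) P6.
have P8 : 3 * (l * L * N) <= m / 4.
  have := ler_wpM2r (ltW N0) le; rewrite /m.
  have : 0 <= l * N by rewrite mulr_ge0 ?ltW. lra.
rewrite /m in slope bm P8 *; lra.
Qed.

End Semismooth.

(** * Mean value theorem along segments *)

Section MeanValue.
Context {R : realType} {n : nat}.

(** Passage to the limit in estimates whose error is linear in a small parameter. *)
Lemma le_of_small (A B C l0 : R) : 0 < l0 ->
  (forall l, 0 < l <= l0 -> A <= B + l * C) -> A <= B.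
Proof.
move=> l00 AB; apply/ler_addgt0Pr => e e0.
have C0 : 0 < `|C| + 1 by rewrite ltr_wpDl.
pose l := Num.min l0 (e / (`|C| + 1)).
have lP : 0 < l <= l0 by rewrite lt_min l00 divr_gt0 //= ge_min lexx.
apply: le_trans (AB _ lP) _; rewrite lerD2l.
apply: (@le_trans _ _ (l * (`|C| + 1))).
  by rewrite ler_wpM2l ?(ltW (andP lP).1) // (le_trans (ler_norm _)) // lerDl.
by rewrite -ler_pdivlMr // ge_min lexx orbT.
Qed.

Lemma has_gradient_line (phi : 'rV[R]_n -> R) gx a b t :
  has_gradient phi (a + t *: b) gx ->
  is_derive t 1 (fun s : R => phi (a + s *: b)) (dotv gx b).
Proof.
move=> grad.
pose q h : R := h^-1 *: (phi (a + (h *: (1 : R) + t) *: b) - phi (a + t *: b)).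
have cv : (q @ 0^' --> dotv gx b)%classic.
  apply/cvgrPdist_le => e e0.
  have b1 : 0 < normv b + 1 by rewrite ltr_wpDl ?normv_ge0.
  have [d [d0 dP]] := grad (e / (normv b + 1)) ltac:(by rewrite divr_gt0).
  near=> h.
  have h0 : h != 0 by near: h; exact: nbhs_dnbhs_neq.
  have hd : `|h| < d / (normv b + 1).
    near: h; apply: dnbhs0_lt; by rewrite divr_gt0.
  have hb : a + (h *: (1 : R) + t) *: b - (a + t *: b) = h *: b.
    by rewrite opprD addrACA subrr add0r -scalerBl addrK /GRing.scale /= mulr1.
  have /dP : normv (a + (h *: (1 : R) + t) *: b - (a + t *: b)) < d.
    rewrite hb normvZ; move: hd; rewrite ltr_pdivlMr // => hd.
    by apply: le_lt_trans hd; rewrite ler_wpM2l // lerDl.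
  rewrite hb normvZ dotvZr => ineq.
  rewrite /q distrC -[X in `|_ - X|](mulKf h0) /GRing.scale /= -mulrBr normrM normfV.
  rewrite mulrC ler_pdivrMr ?normr_gt0 //; apply: le_trans ineq _.
  rewrite mulrCA [leRHS]mulrC ler_wpM2l // mulrAC ler_pdivrMr // ler_wpM2l ?(ltW e0) //.
  by rewrite lerDl.
by apply: DeriveDef; [apply/cvg_ex; exists (dotv gx b)|exact: cvg_lim].
Unshelve. all: by end_near. Qed.

Lemma MVT01 (f df : R -> R) :
  (forall t : R, 0 <= t <= 1 -> is_derive t 1 f (df t)) ->
  exists2 t : R, 0 <= t <= 1 & f 1 - f 0 = df t.
Proof.
move=> fdf.
have [t||t] := @MVT R f df 0 1 ltr01.
- by rewrite in_itv /= => /andP[t0 t1]; apply: fdf; rewrite !ltW.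
- apply: derivable_within_continuous => t; rewrite in_itv /= => /fdf tder.
  exact: (@ex_derive _ _ _ _ _ _ _ tder).
by rewrite in_itv subr0 mulr1 => /andP[t0 t1] ?; exists t => //; rewrite !ltW.
Qed.

Lemma gradient_mean_value (phi : 'rV[R]_n -> R) (g : 'rV[R]_n -> 'rV[R]_n) x k :
  (forall t : R, 0 <= t <= 1 -> has_gradient phi (x + t *: k) (g (x + t *: k))) ->
  exists2 t : R, 0 <= t <= 1 & phi (x + k) - phi x = dotv (g (x + t *: k)) k.
Proof.
move=> grad.
have [t t01|t t01 /= tE] := MVT01 (fun s => phi (x + s *: k))
    (fun s => dotv (g (x + s *: k)) k).
  exact: has_gradient_line (grad _ t01).
by exists t => //; rewrite -tE scale1r scale0r addr0.
Qed.

End MeanValue.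

(** * The Euler defect and the error of a Newton step *)

Section NewtonStep.
Context {R : realType} {n : nat} (phi : 'rV[R]_n -> R) (g : 'rV[R]_n -> 'rV[R]_n)
  (xb : 'rV[R]_n) (r L : R).
Hypotheses (r0 : 0 < r) (L0 : 0 <= L) (gxb : g xb = 0)
  (grad : forall x, normv (x - xb) < r -> has_gradient phi x (g x))
  (lip : forall x y, normv (x - xb) < r -> normv (y - xb) < r ->
     normv (g x - g y) <= L * normv (x - y))
  (ss : semismooth_star g xb).

Let G h := g (xb + h).
Let Phi h := phi (xb + h).

Let lipG h h' : normv h < r -> normv h' < r -> normv (G h - G h') <= L * normv (h - h').
Proof.
move=> hr h'r; have := lip (xb + h) (xb + h').
rewrite ![xb + _ - xb]addrAC subrr !add0r opprD addrACA subrr add0r; exact.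
Qed.

Let gradPhi h : normv h < r -> has_gradient Phi h (G h).
Proof.
move=> hr e e0; have := grad (xb + h); rewrite addrAC subrr add0r => /(_ hr _ e0).
move=> [d [d0 dP]]; exists d; split=> // y yd; have := dP (xb + y).
rewrite /Phi opprD addrACA subrr add0r; exact.
Qed.

(** Testing the one-sided estimate with the unit vector opposite to the defect recovers the norm of
    the defect. *)
Lemma near_homogeneous (e : R) : 0 < e -> exists delta l0, [/\ 0 < delta, 0 < l0 &
  forall h l, normv h <= delta -> 0 < l <= l0 ->
    normv (G ((1 + l) *: h) - (1 + l) *: G h) <= e * l * normv h].
Proof.
move=> e0; have [d [l0 [d0 l00 dP]]] := near_homogeneous_dotv _ _ _ _ r0 L0 gxb lip ss e e0.
exists d, l0; split=> // h l hd /[dup] lP /andP[lgt0 _].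
set D := G _ - _.
have [->|/eqP D0] := eqVneq D 0.
  by rewrite normv0 !mulr_ge0 ?normv_ge0 // ltW.
have N0 := normv_gt0 _ D0.
have w1 : normv (- (normv D)^-1 *: D) <= 1.
  by rewrite normvZ normrN gtr0_norm ?invr_gt0 // mulVf // gt_eqF.
have := dP h _ l hd lP w1.
rewrite -[_ - (1 + l) * _](_ : dotv (- (normv D)^-1 *: D) D = _); last first.
  by rewrite {2}/D dotvDr dotvNr dotvZr.
rewrite dotvZl -sqr_normv expr2 mulNr mulKf ?gt_eqF // lerN2.
by [].
Qed.

Let E h := dotv h (G h) - 2 * Phi h.

(* [E h] is the limit of [(Phi ((1 + l) h) - (1 + l)^2 Phi h) / l] as l goes
   to 0, and near homogeneity of G bounds the gradients of these quotients. *)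
Lemma euler_defect_lipschitz (e : R) : 0 < e -> exists2 delta, 0 < delta &
  forall h k, normv h + normv k <= delta ->
    `|E (h + k) - E h| <= e * (normv h + normv k) * normv k.
Proof.
(* Half of [e] compensates for a factor [1 + l <= 2] in the derivative below. *)
move=> e0; have [d [l0 [d0 l00 dP]]] := near_homogeneous (e / 2) ltac:(lra).
exists (Num.min d (r / 3)); first by rewrite lt_min d0 divr_gt0.
move=> h k; rewrite le_min => /andP[hkd hkr].
have h0 := normv_ge0 h; have k0 := normv_ge0 k; have r3 := r0; have L3 := L0.
(* Error of the expansion in [l] to first order; [QP] shows by the mean value theorem that it is of
   order [l ^+ 2]. *)
pose Q l h := Phi ((1 + l) *: h) - (1 + l) ^+ 2 * Phi h - l * E h.
have QP (l : R) h' : 0 < l <= 1 -> normv h' <= r / 3 ->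
    `|Q l h'| <= l ^+ 2 * (L * normv h' ^+ 2 + `|Phi h'|).
  move=> /andP[lgt0 l1] h'r; have h'0 := normv_ge0 h'.
  have ray (t : R) : 0 <= t <= 1 -> normv (h' + t *: (l *: h')) < r.
    move=> /andP[t0 t1]; rewrite scalerA -[X in normv (X + _)]scale1r -scalerDl normvZ.
    have tl0 : 0 <= t * l by rewrite mulr_ge0 // ltW.
    have : t * l * normv h' <= normv h' by rewrite ler_piMl // mulr_ile1 // ltW.
    rewrite ger0_norm; move: r0; lra.
  have [t t01] := gradient_mean_value Phi G h' (l *: h') (fun t t01 => gradPhi _ (ray t t01)).
  rewrite dotvZr => tE.
  have -> : Q l h' = l * dotv (G (h' + t *: (l *: h')) - G h') h' - l ^+ 2 * Phi h'.
    move: tE; rewrite -[X in Phi (X + _)]scale1r -scalerDl => tE.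
    rewrite /Q /E dotvDl dotvNl (dotvC h'); move: tE; set A := dotv _ _.
    by set B := Phi (_ *: _) => tE; lra.
  apply: le_trans (ler_normB _ _) _.
  rewrite mulrDr [`|l ^+ 2 * _|]normrM (ger0_norm (sqr_ge0 l)) lerD2r.
  rewrite normrM gtr0_norm // -mulrA ler_pM2l //.
  apply: le_trans (normr_dotv_le _ _) _.
  have h'lt : normv h' < r by lra.
  have := lipG _ _ (ray t t01) h'lt; rewrite addrAC subrr add0r !normvZ.
  have [t0 t1] := andP t01.
  rewrite !ger0_norm // ?(ltW lgt0) // => P1.
  have P2 : L * (t * (l * normv h')) <= L * (l * normv h').
    by rewrite ler_wpM2l // ler_piMl // mulr_ge0 // ltW.
  have := ler_wpM2r h'0 (le_trans P1 P2); lra.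
have gl : 0 < Num.min l0 1 by rewrite lt_min l00 ltr01.
apply: (le_of_small _ _ (L * normv (h + k) ^+ 2 + `|Phi (h + k)| +
  (L * normv h ^+ 2 + `|Phi h|)) _ gl) => l /andP[lgt0]; rewrite le_min => /andP[ll0 l1].
have seg (t : R) : 0 <= t <= 1 -> normv (h + t *: k) <= normv h + normv k.
  move=> /andP[t0 t1]; apply: le_trans (normvD _ _) _.
  by rewrite lerD2l normvZ ger0_norm // ler_piMl.
(* The dilation difference along the segment from [h] to [h + k]; its derivative pairs [k] with
   [1 + l] times the homogeneity defect of [G]. *)
pose f t := Phi ((1 + l) *: h + t *: ((1 + l) *: k)) - (1 + l) ^+ 2 * Phi (h + t *: k).
pose df t := dotv (G ((1 + l) *: h + t *: ((1 + l) *: k))) ((1 + l) *: k)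
  - (1 + l) ^+ 2 * dotv (G (h + t *: k)) k.
have dilate t : (1 + l) *: h + t *: ((1 + l) *: k) = (1 + l) *: (h + t *: k).
  by rewrite scalerDr !scalerA (mulrC t).
have [t t01|t t01] := MVT01 f df.
  have hk := seg t t01.
  apply: is_deriveB; last apply: is_deriveZ; apply: has_gradient_line; apply: gradPhi.
    by rewrite dilate normvZ gtr0_norm; [nra|lra].
  lra.
have -> : f 1 - f 0 = l * (E (h + k) - E h) + Q l (h + k) - Q l h.
  rewrite /f /Q !scale1r !scale0r !addr0 -scalerDr; ring.
have hk := seg t t01.
have -> : df t = (1 + l) * dotv (G ((1 + l) *: (h + t *: k)) - (1 + l) *: G (h + t *: k)) k.
  by rewrite /df dilate dotvZr dotvDl dotvNl dotvZl; ring.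
move=> fE.
have := QP l (h + k) ltac:(by rewrite lgt0) ltac:(by apply: le_trans (normvD _ _) _; lra).
have := QP l h ltac:(by rewrite lgt0) ltac:(lra).
have P1 := dP _ l (le_trans hk hkd) ltac:(by rewrite lgt0).
set D := _ - _ in P1 fE *.
have P2 : normv D * normv k <= e / 2 * l * (normv h + normv k) * normv k.
  apply: ler_wpM2r => //; apply: le_trans P1 _; rewrite ler_wpM2l //.
  by rewrite mulr_ge0 ?ltW //; lra.
have P3 := le_trans (normr_dotv_le D k) P2.
have P4 : `|(1 + l) * dotv D k| <= 2 * (e / 2 * l * (normv h + normv k) * normv k).
  by rewrite normrM ler_pM // ger0_norm; lra.
rewrite -fE in P4; move: P4.
move: (Q l h) (Q l (h + k)) (E (h + k) - E h) => q q' dE P4 qP q'P.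
have P5 : `|l * dE| <= `|l * dE + q' - q| + `|q| + `|q'|.
  rewrite {1}(_ : l * dE = (l * dE + q' - q) + (q - q')); last by ring.
  apply: le_trans (ler_normD _ _) _; have := ler_normB q q'; lra.
rewrite -(ler_pM2l lgt0); move: P5; rewrite normrM gtr0_norm //; lra.
Qed.

(** Expand [E (h + t *: k) - E h], writing the increment of [Phi] by the mean value theorem. Up to
    order [t ^+ 2] it equals the right-hand side minus [t * dotv (G h) k], and the Lipschitz bound
    on [E] makes it small. *)
Lemma hessian_ray (e : R) : 0 < e -> exists2 delta, 0 < delta &
  forall h k, normv h < delta -> exists C t0, 0 < t0 /\ forall t, 0 < t <= t0 ->
    t * dotv (G h) k - t * (e * normv h * normv k) - t ^+ 2 * C <=
      dotv h (G (h + t *: k) - G h).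
Proof.
move=> e0; have [d d0 dP] := euler_defect_lipschitz e e0.
exists (Num.min d (r / 2)); first by rewrite lt_min d0 divr_gt0.
move=> h k; rewrite lt_min => /andP[hd hr]; have r3 := r0; have L3 := L0.
have k1 : 0 < normv k + 1 by rewrite ltr_wpDl ?normv_ge0.
(* The [e] comes from the Lipschitz bound of [E], one [L] from [G (h + t *: k)], and [2 * L] from
   the mean value term. *)
exists ((e + 3 * L) * normv k ^+ 2), (Num.min (d - normv h) (r / 2) / (normv k + 1)).
split; first by rewrite divr_gt0 // lt_min subr_gt0 hd divr_gt0.
move=> t /andP[t0]; rewrite ler_pdivlMr // le_min => /andP[td tr].
have k0 := normv_ge0 k.
have ntk : normv (t *: k) = t * normv k by rewrite normvZ gtr0_norm.
have seg (s : R) : 0 <= s <= 1 -> normv (h + s *: (t *: k)) < r.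
  move=> /andP[s0 s1]; apply: le_lt_trans (normvD _ _) _; rewrite normvZ ntk ger0_norm //.
  have := ler_piMl (mulr_ge0 (ltW t0) k0) s1; lra.
have [s s01] := gradient_mean_value Phi G h (t *: k) (fun s s01 => gradPhi _ (seg s s01)).
have := dP h (t *: k) ltac:(rewrite ntk; lra).
rewrite ler_norml ntk => /andP[+ _].
have hltr : normv h < r by lra.
have in1 : 0 <= (1 : R) <= 1 by rewrite ler01 lexx.
have P1 := lipG _ _ (seg s s01) hltr; have P2 := lipG _ _ (seg 1 in1) hltr.
move: P1 P2; rewrite scale1r ![h + _ - h]addrAC !subrr !add0r normvZ ntk => P1 P2.
have {}P1 : normv (G (h + s *: (t *: k)) - G h) <= L * (t * normv k).
  apply: le_trans P1 _; rewrite ler_wpM2l //; have [s0 s1] := andP s01.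
  by rewrite ger0_norm // ler_piMl // mulr_ge0 // ltW.
have Q1 := le_trans (normr_dotv_le _ k) (ler_wpM2r k0 P1).
have Q2 := le_trans (normr_dotv_le _ k) (ler_wpM2r k0 P2).
move: Q1 Q2; rewrite !ler_norml => /andP[Q1 _] /andP[_ Q2].
have {}Q1 := ler_wpM2l (ltW t0) Q1; have {}Q2 := ler_wpM2l (ltW t0) Q2.
rewrite /E !dotvDl !dotvDr !dotvNl !dotvNr !dotvZr in Q1 Q2 *.
rewrite dotvZl (dotvC k) => P3 P4.
lra.
Qed.

(** With [k = - (h + w)], move from [y] to [y + t *: k] and let [D] be the increment of [g]. Strong
    monotonicity bounds [dotv D k = - dotv h D - dotv w D] below; [hessian_ray] bounds the first
    term above and the regular normal the second. Divide by [t] and let [t] tend to 0. *)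
Lemma newton_step_reg_normal (c rc e : R) : 0 < c -> 0 < rc -> 0 < e ->
  (forall x y, normv (x - xb) < rc -> normv (y - xb) < rc ->
     c * normv (x - y) ^+ 2 <= dotv (g x - g y) (x - y)) ->
  exists2 delta, 0 < delta & forall y q w, normv (y - xb) < delta ->
    reg_normal (gph g) (y, g y) (q, - w) ->
    c * normv (y - xb + w) <= normv (q + g y) + e * normv (y - xb).
Proof.
move=> c0 rc0 e0 mono; have [d d0 dP] := hessian_ray e e0.
have m0 : 0 < Num.min r rc by rewrite lt_min r0.
exists (Num.min d (Num.min r rc / 2)); first by rewrite lt_min d0 divr_gt0.
move=> y q w; rewrite lt_min => /andP[yd ym] reg.
set h := y - xb in yd ym *.
have yE : y = xb + h by rewrite /h addrC subrK.
have Gh : g y = G h by rewrite /G -yE.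
pose k := - (h + w).
have -> : normv (h + w) = normv k by rewrite normvN.
have [->|/eqP k_neq0] := eqVneq k 0.
  by rewrite normv0 mulr0 addr_ge0 ?mulr_ge0 ?normv_ge0 // ltW.
have k0 := normv_gt0 _ k_neq0.
have [C [t0 [t00 tP]]] := dP h k yd.
rewrite -(ler_pM2r k0).
have lipy x : normv (x - y) < Num.min r rc / 2 -> normv (g x - g y) <= L * normv (x - y).
  move=> xy; have mr : Num.min r rc <= r by rewrite ge_min lexx.
  apply: lip; last by rewrite -/h; lra.
  by rewrite -(subrK y x) -addrA; apply: le_lt_trans (normvD _ _) _; rewrite -/h; lra.
apply/ler_addgt0Pr => b b0.
have bk : 0 < b / normv k by rewrite divr_gt0.
have [rho rho0 regk] := reg_normal_gph_lipschitz _ _ _ _ _ _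
  (divr_gt0 m0 (ltr0n _ 2)) L0 lipy reg _ bk.
have t10 : 0 < Num.min t0 (Num.min rho (Num.min r rc / 2) / (2 * normv k)).
  by rewrite lt_min t00 divr_gt0 ?mulr_gt0 // lt_min rho0 divr_gt0.
apply: (le_of_small _ _ C _ t10) => t /andP[tgt0]; rewrite le_min => /andP[tt0].
rewrite ler_pdivlMr ?mulr_gt0 // le_min => /andP[trho tm].
have tk0 : 0 < t * normv k by rewrite mulr_gt0.
have ntk : normv (t *: k) = t * normv k by rewrite normvZ gtr0_norm.
have xyk : y + t *: k - y = t *: k by rewrite addrAC subrr add0r.
have := regk (y + t *: k); rewrite xyk ntk => /(_ ltac:(lra)).
have := tP t ltac:(by rewrite tgt0).
have mrc : Num.min r rc <= rc by rewrite ge_min lexx orbT.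
have htk : y + t *: k - xb = h + t *: k by rewrite /h [LHS]addrAC.
have ht : normv (y + t *: k - xb) < rc.
  by rewrite htk; apply: le_lt_trans (normvD _ _) _; rewrite ntk; lra.
have hrc : normv (y - xb) < rc by rewrite -/h; lra.
have := mono _ _ ht hrc; rewrite xyk ntk.
have -> : g (y + t *: k) = G (h + t *: k) by rewrite /G /h addrA (addrC xb) subrK.
rewrite -Gh; set D := _ - _ => P1 P2 P3.
have P4 : dotv D k = - dotv h D - dotv w D.
  by rewrite /k dotvNr dotvDr !(dotvC D) opprD.
have P5 : - dotv (q + g y) k <= normv (q + g y) * normv k.
  by rewrite -dotvNr -[normv k]normvN dotv_le.
move: P1 P3 P5; rewrite !dotvZr P4 dotvDl => P1 P3 P5.
rewrite -(ler_pM2l tgt0).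
have P6 : b / normv k * (t * normv k) = t * b by field; rewrite gt_eqF.
rewrite P6 in P3.
have P7 := ler_wpM2l (ltW tgt0) P5.
have : c * t * normv k ^+ 2 <= - dotv h D - dotv w D by rewrite -(ler_pM2l tgt0); lra.
lra.
Qed.

(** An element of [Upsilon_star] is a limit of regular normals at nearby points, along which
    [q + g y] tends to 0, so the previous estimate passes to the limit. *)
Lemma newton_step (c rc e : R) : 0 < c -> 0 < rc -> 0 < e ->
  (forall x y, normv (x - xb) < rc -> normv (y - xb) < rc ->
     c * normv (x - y) ^+ 2 <= dotv (g x - g y) (x - y)) ->
  exists2 delta, 0 < delta & forall x d, normv (x - xb) < delta ->
    Upsilon_star g x d -> normv (x - d - xb) <= e * normv (x - xb).
Proof.
move=> c0 rc0 e0 mono.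
have [delta delta0 deltaP] := newton_step_reg_normal c rc (c * e) c0 rc0 (mulr_gt0 c0 e0) mono.
exists (Num.min delta r); first by rewrite lt_min delta0.
move=> x d; rewrite lt_min => /andP[xdelta xr] [z [vs [gz [zx [vsx reg]]]]].
have L3 := L0.
rewrite -(ler_pM2l c0).
apply/ler_addgt0Pr => b b0.
(* The first two bounds keep [y] where the estimates hold; the denominator collects the coefficients
   of all approximation errors. *)
pose b' := Num.min (Num.min (delta - normv (x - xb)) (r - normv (x - xb)))
  (b / (c * 2 + 1 + L + c * e)).
have S0 : 0 < c * 2 + 1 + L + c * e by have := mulr_gt0 c0 e0; lra.
have b'0 : 0 < b' by rewrite !lt_min !subr_gt0 xdelta xr divr_gt0.
have b'd : b' <= delta - normv (x - xb) by rewrite !ge_min lexx.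
have b'r : b' <= r - normv (x - xb) by rewrite !ge_min lexx !orbT.
have b'S : b' * (c * 2 + 1 + L + c * e) <= b.
  by rewrite -ler_pdivlMr // !ge_min lexx !orbT.
have [N NP] := cvgp_fst _ _ zx _ b'0.
have [M1 M1P] := cvgp_fst _ _ vsx _ b'0.
have [M2 M2P] := cvgp_snd _ _ vsx _ b'0.
pose j := maxn N (maxn M1 M2).
have {NP} := NP j (leq_maxl _ _).
have {M1P} := M1P j ltac:(by rewrite !leq_max leqnn orbT).
have {M2P} := M2P j ltac:(by rewrite !leq_max leqnn !orbT).
have := reg j; have := gz j; case: (z j) (vs j) => y gy [q p]; rewrite /gph /= => ->.
rewrite opprK => regj pd qg yx.
have yxb : normv (y - xb) <= normv (y - x) + normv (x - xb).
  by rewrite -{1}(subrK x y) -addrA normvD.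
have yd : normv (y - xb) < delta by lra.
have := deltaP y q (- p) yd; rewrite opprK => /(_ regj).
have P1 : normv (q + g y) <= normv (q - - g x) + normv (g y - g x).
  by rewrite opprK (_ : q + g y = (q + g x) + (g y - g x)) ?normvD // addrA addrAC addrK.
have P2 : normv (g y - g x) <= L * normv (y - x) by apply: lip => //; lra.
have P3 : normv (x - d - xb) <= normv (y - xb - p) + normv (y - x) + normv (p - d).
  have -> : x - d - xb = (y - xb - p) - (y - x) + (p - d).
    by apply/rowP => i; rewrite !mxE; ring.
  by apply: le_trans (normvD _ _) _; rewrite lerD2r normvB.
have P4 := ler_wpM2l (ltW c0) P3.
have P5 := ler_wpM2l (ltW (mulr_gt0 c0 e0)) yxb.
have P6 := ler_wpM2l L0 (ltW yx).
have P7 := ler_wpM2l (ltW c0) (ltW yx).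
have P8 := ler_wpM2l (ltW c0) (ltW pd).
have P9 := ler_wpM2l (ltW (mulr_gt0 c0 e0)) (ltW yx).
lra.
Qed.

End NewtonStep.

(** * Surjectivity of the coderivative under strong monotonicity *)

Section CoderivativeSurjective.
Context {R : realType} {n : nat} (g : 'rV[R]_n -> 'rV[R]_n) (x q : 'rV[R]_n) (rho L c : R).
Hypotheses (rho0 : 0 < rho) (L0 : 0 <= L) (c0 : 0 < c)
  (lip : forall y z, normv (y - x) <= rho -> normv (z - x) <= rho ->
     normv (g y - g z) <= L * normv (y - z))
  (mono : forall y, normv (y - x) <= rho ->
     c * normv (y - x) ^+ 2 <= dotv (g y - g x) (y - x)).

(** Minimize [- dotv q y + K * normv (g y - g x) ^+ 2] over the ball. Monotonicity makes the penalty
    dominate the square of the distance to [x], so a large [K] gives an interior minimizer and hence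
    a normal; the bound on [K * normv (g y - g x)] is uniform in [K]. *)
Lemma reg_normal_near (K : R) : normv q < K * (c ^+ 2 * rho) ->
  exists y, [/\ c ^+ 2 * K * normv (y - x) <= normv q, c * K * normv (g y - g x) <= normv q &
    reg_normal (gph g) (y, g y) (q, - ((2 * K) *: (g y - g x)))].
Proof.
move=> qK; have r1 := rho0; have c1 := c0; have L1 := L0; have q0 := normv_ge0 q.
have c2r : 0 < c ^+ 2 * rho by rewrite mulr_gt0 // exprn_gt0.
have K0 : 0 < K by rewrite -(pmulr_lgt0 _ c2r); lra.
have xx : normv (x - x) <= rho by rewrite subrr normv0 ltW.
pose F y := - dotv q y + K * normv (g y - g x) ^+ 2.
have [y z yr zr|y yr ymin] := @min_ball R n x rho (normv q + 2 * K * (L * rho) * L) F (ltW r1).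
  have Dy : normv (g y - g x) <= L * rho.
    by apply: le_trans (lip _ _ yr xx) _; rewrite ler_wpM2l.
  have Dz : normv (g z - g x) <= L * rho.
    by apply: le_trans (lip _ _ zr xx) _; rewrite ler_wpM2l.
  have P1 : normv (g y - g x) <= normv (g z - g x) + L * normv (y - z).
    rewrite -(subrK (g z) (g y)) -addrA addrC; apply: le_trans (normvD _ _) _.
    by rewrite lerD2l lip.
  have P2 : dotv q (z - y) <= normv q * normv (y - z) by rewrite normvBC dotv_le.
  rewrite dotvDr dotvNr in P2.
  have P3 : 0 <= L * normv (y - z) by rewrite mulr_ge0 ?normv_ge0.
  have P4 : normv (g y - g x) ^+ 2 - normv (g z - g x) ^+ 2 <=
      2 * (L * rho) * (L * normv (y - z)).
    have := normv_ge0 (g y - g x); have := normv_ge0 (g z - g x); nra.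
  have := ler_wpM2l (ltW K0) P4; rewrite /F; lra.
have yx0 := normv_ge0 (y - x); have D0 := normv_ge0 (g y - g x).
have P1 : c * normv (y - x) <= normv (g y - g x).
  have [->|/eqP yx] := eqVneq (y - x) 0; first by rewrite normv0 mulr0.
  rewrite -(ler_pM2r (normv_gt0 _ yx)); have := mono _ yr.
  have := dotv_le (g y - g x) (y - x); lra.
have P2 : K * normv (g y - g x) ^+ 2 <= normv q * normv (y - x).
  have := ymin x xx; rewrite /F subrr normv0.
  have := dotv_le q (y - x); rewrite dotvDr dotvNr; lra.
have P3 : c * K * normv (g y - g x) <= normv q.
  have [->|/eqP D] := eqVneq (g y - g x) 0; first by rewrite normv0 mulr0.
  rewrite -(ler_pM2r (normv_gt0 _ D)).
  have := ler_wpM2l (ltW c1) P2; have := ler_wpM2l q0 P1; lra.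
have P4 : c ^+ 2 * K * normv (y - x) <= normv q.
  by apply: le_trans P3; have := ler_wpM2l (ltW (mulr_gt0 c1 K0)) P1; lra.
exists y; split=> //.
apply: (@reg_normal_gph_quadratic _ _ _ _ _ _ (rho - normv (y - x)) K).
  rewrite subr_gt0 -(ltr_pM2l (mulr_gt0 (exprn_gt0 2 c1) K0)).
  by apply: le_lt_trans P4 _; rewrite mulrAC mulrC.
move=> z zy; have zr : normv (z - x) <= rho.
  by rewrite -(subrK y z) -addrA; apply: le_trans (normvD _ _) _; lra.
have := ymin z zr; rewrite /F -(subrK (g y) (g z)) -addrA.
move: (g z - g y) (g y - g x) => D1 D2.
have := mulr_ge0 (ltW K0) (sqr_ge0 (normv (z - y))).
rewrite !sqr_normv !dotvE (dotvC D1 D2); lra.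
Qed.

(** As the penalty grows, the base points tend to [x] while the second components of the normals
    stay bounded, so a subsequence converges. *)
Lemma coderiv_surjective : exists w, coderiv g x w q.
Proof.
have r1 := rho0; have c1 := c0; have L1 := L0; have q0 := normv_ge0 q.
(* The added 1 makes every multiple [k.+1%:R * K1] strictly admissible, including for [q = 0]. *)
pose K1 := (normv q + 1) / (c ^+ 2 * rho).
have c2 : 0 < c ^+ 2 by rewrite exprn_gt0.
have c2r : 0 < c ^+ 2 * rho by rewrite mulr_gt0.
have K10 : 0 < K1 by rewrite divr_gt0 //; lra.
have K1E : K1 * (c ^+ 2 * rho) = normv q + 1 by rewrite divfK // gt_eqF.
clearbody K1.
have k1 (k : nat) : 1 <= (k.+1%:R : R) by rewrite ler1n.
have /choice[y yP] : forall k : nat, exists y,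
    [/\ c ^+ 2 * (k.+1%:R * K1) * normv (y - x) <= normv q,
      c * (k.+1%:R * K1) * normv (g y - g x) <= normv q &
      reg_normal (gph g) (y, g y) (q, - ((2 * (k.+1%:R * K1)) *: (g y - g x)))].
  by move=> k; apply: reg_normal_near; rewrite -mulrA K1E; have := k1 k; nra.
pose w k := (2 * (k.+1%:R * K1)) *: (g (y k) - g x).
have wq k : normv (w k) <= 2 * normv q / c.
  have [_ h _] := yP k; rewrite ler_pdivlMr // normvZ ger0_norm; first by lra.
  by rewrite !mulr_ge0 // ltW.
have yx k : normv (y k - x) <= rho * k.+1%:R^-1.
  have [h _ _] := yP k; rewrite ler_pdivlMr ?ltr0n //.
  rewrite -(ler_pM2l c2) -(ler_pM2r K10) [leRHS]mulrC K1E; lra.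
have [f [l [fk fl]]] := bounded_cvgv w _ wq.
exists l, (fun k => (y (f k), g (y (f k)))), (fun k => (q, - w (f k))).
have yfx : cvgv (fun k => y (f k)) x.
  apply: (@cvgv_sub _ _ y) => // e e0.
  have [N NP] := archi_inv _ (divr_gt0 e0 r1).
  exists N => k /NP; rewrite ltr_pdivlMr // mulrC; exact: le_lt_trans.
split=> //; split; last split.
- apply: cvgp_pair => // e e0.
  have [N NP] := yfx (Num.min rho (e / (L + 1)))
    ltac:(by rewrite lt_min r1 divr_gt0 // ltr_wpDl).
  exists N => k /NP; rewrite lt_min => /andP[yr]; rewrite ltr_pdivlMr ?ltr_wpDl // => ye.
  apply: le_lt_trans (lip _ _ (ltW yr) _) _; first by rewrite subrr normv0 ltW.
  by have := normv_ge0 (y (f k) - x); lra.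
- by apply: cvgp_pair; [exact: cvgv_cst|exact: cvgvN].
- by move=> k; have [_ _] := yP (f k).
Qed.

End CoderivativeSurjective.

(** * From tilt stability to strong monotonicity of the gradient *)

Section TiltStability.
Context {R : realType} {n : nat} (phi : 'rV[R]_n -> R) (g : 'rV[R]_n -> 'rV[R]_n)
  (xb : 'rV[R]_n) (r L kappa gamma rho : R).
Hypotheses (r0 : 0 < r) (L0 : 0 <= L) (kappa0 : 0 < kappa) (gamma0 : 0 < gamma)
  (rho0 : 0 < rho)
  (grad : forall x, normv (x - xb) < r -> has_gradient phi x (g x))
  (lip : forall x y, normv (x - xb) < r -> normv (y - xb) < r ->
     normv (g x - g y) <= L * normv (x - y))
  (Mtilt0 : forall x, Mtilt phi xb gamma 0 x <-> x = xb)
  (Mtilt_ex : forall v, normv v < rho -> exists x, Mtilt phi xb gamma v x)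
  (Mtilt_lip : forall v1 v2 x1 x2, normv v1 < rho -> normv v2 < rho ->
     Mtilt phi xb gamma v1 x1 -> Mtilt phi xb gamma v2 x2 ->
     normv (x1 - x2) <= kappa * normv (v1 - v2)).

(** Fermat's rule at an interior minimizer, tested in the direction [v - g x]. *)
Lemma Mtilt_gradient v x : normv (x - xb) < r -> normv (x - xb) < gamma ->
  Mtilt phi xb gamma v x -> g x = v.
Proof.
move=> xr xg [_ xmin]; apply/esym/subr0_eq/normv_eq0/eqP; rewrite eq_le normv_ge0 andbT.
set k := v - g x; apply/ler_addgt0Pr => e e0; rewrite add0r.
have [->|/eqP/normv_gt0 k0] := eqVneq k 0; first by rewrite normv0 ltW.
have [d [d0 dP]] := grad _ xr _ e0.
pose t := Num.min (d / 2) (gamma - normv (x - xb)) / normv k.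
have m0 : 0 < Num.min (d / 2) (gamma - normv (x - xb)).
  by rewrite lt_min subr_gt0 xg divr_gt0.
have t0 : 0 < t by rewrite divr_gt0.
have tk : normv (t *: k) = Num.min (d / 2) (gamma - normv (x - xb)).
  by rewrite normvZ gtr0_norm // divfK // gt_eqF.
have tkd : normv (t *: k) <= d / 2 by rewrite tk ge_min lexx.
have tkg : normv (t *: k) <= gamma - normv (x - xb) by rewrite tk ge_min lexx orbT.
have xkx : x + t *: k - x = t *: k by rewrite addrAC subrr add0r.
have := dP (x + t *: k); rewrite xkx => /(_ ltac:(lra)); rewrite ler_norml => /andP[_ P1].
have P2 : normv (x + t *: k - xb) <= gamma.
  by rewrite addrAC; apply: le_trans (normvD _ _) _; lra.
have := xmin _ P2; rewrite dotvDr => P3.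
have P4 : dotv (v - g x) (t *: k) <= e * normv (t *: k).
  by rewrite dotvDl dotvNl; lra.
move: P4; rewrite -/k dotvZr -sqr_normv normvZ gtr0_norm // [leRHS]mulrCA ler_pM2l //.
by rewrite expr2 ler_pM2r.
Qed.

Lemma tilt_gradient0 : g xb = 0.
Proof. by apply: Mtilt_gradient; rewrite ?subrr ?normv0 //; apply/Mtilt0. Qed.

Let normv00 : normv (0 : 'rV[R]_n) < rho. Proof. by rewrite normv0. Qed.

Let Mtilt_dist v x : normv v < rho -> Mtilt phi xb gamma v x ->
  normv (x - xb) <= kappa * normv v.
Proof.
by move=> vr vx; rewrite -[in leRHS](subr0 v); apply: Mtilt_lip => //; apply/Mtilt0.
Qed.

(** Compare [z] with the solution [x'] for the tilt [w], and [x'] with [x]. The gain is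
    [dotv (w - v) (z - x)] minus at most [kappa * normv (w - v) ^+ 2]; the step [(2 * kappa)^-1]
    maximizes this difference. *)
Lemma tilt_growth v x z : normv v < rho -> normv (v + (2 * kappa)^-1 *: (z - x)) < rho ->
  Mtilt phi xb gamma v x -> normv (z - xb) <= gamma ->
  phi x + dotv v (z - x) + (4 * kappa)^-1 * normv (z - x) ^+ 2 <= phi z.
Proof.
move=> vr; set w := v + _ => wr vx zg; have [x' wx'] := Mtilt_ex _ wr.
have P1 := wx'.2 _ zg; have P2 := vx.2 _ wx'.1.
have P3 : dotv (w - v) (x' - x) <= kappa * normv (w - v) ^+ 2.
  apply: le_trans (dotv_le _ _) _.
  rewrite mulrC expr2 mulrA; rewrite ler_wpM2r ?normv_ge0 //; exact: Mtilt_lip.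
have wv : w - v = (2 * kappa)^-1 *: (z - x) by rewrite /w addrAC subrr add0r.
have P4 : dotv (w - v) (z - x) = (2 * kappa)^-1 * normv (z - x) ^+ 2.
  by rewrite wv dotvZl sqr_normv.
have P5 : kappa * normv (w - v) ^+ 2 = (4 * kappa)^-1 * normv (z - x) ^+ 2.
  by rewrite wv !sqr_normv dotvZl dotvZr; field; rewrite gt_eqF.
have P6 : (2 * kappa)^-1 * normv (z - x) ^+ 2 = 2 * ((4 * kappa)^-1 * normv (z - x) ^+ 2).
  by field; rewrite gt_eqF.
rewrite P6 in P4; rewrite P5 in P3.
move: P3 P4 P1 P2; rewrite !dotvDl !dotvDr !dotvNl !dotvNr; lra.
Qed.

(* The conjugate function v |-> max_x (<v, x> - phi x) is convex and its
   gradient is the solution map, so minimizing it minus <v, x> solves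
   M v = x; the quadratic upper bound on phi keeps the minimizer interior. *)
Lemma tilt_surjective : exists2 delta, 0 < delta & forall x, normv (x - xb) < delta ->
  exists2 v, normv v < rho & Mtilt phi xb gamma v x.
Proof.
have r1 := r0; have L1 := L0; have g1 := gamma0; have rh := rho0.
have /choice[M MP] : forall v, exists x, normv v < rho -> Mtilt phi xb gamma v x.
  move=> v; have [/Mtilt_ex[x vx]|_] := ltP (normv v) rho; first by exists x.
  by exists 0.
pose m := Num.min r gamma; have m0 : 0 < m by rewrite lt_min r1.
(* The first bound gives [L * tau <= 1 / 2]; the second keeps [xb + tau *: v] in the region where
   [phi] is controlled. *)
pose tau := Num.min (2 * (L + 1))^-1 (m / rho).
have tau0 : 0 < tau by rewrite lt_min invr_gt0 divr_gt0 // andbT mulr_gt0 // ltr_wpDl.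
have tauL : tau * (2 * (L + 1)) <= 1.
  by rewrite -ler_pdivlMr ?mul1r ?ge_min ?lexx // mulr_gt0 // ltr_wpDl.
have taur : tau * rho <= m by rewrite -ler_pdivlMr // ge_min lexx orbT.
exists (tau * rho / 4) => [|x xd]; first by rewrite divr_gt0 // mulr_gt0.
pose f v := dotv v (M v) - phi (M v).
(* [M v] is a subgradient of the conjugate [f] at [v]. *)
have fM v w : normv v < rho -> normv w < rho -> f v <= f w + dotv (v - w) (M v).
  move=> vr wr; have := (MP _ wr).2 _ (MP _ vr).1; rewrite /f dotvDl dotvNl; lra.
have half (v : 'rV[R]_n) : normv (v - 0) <= rho / 2 -> normv v < rho by rewrite subr0; lra.
have [|v w /half vr /half wr|v vr vmin] := @min_ball R n 0 (rho / 2)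
    (normv xb + kappa * rho + normv x) (fun v => f v - dotv v x); first by lra.
  have P1 : normv (M v) <= normv xb + kappa * rho.
    rewrite -(subrK xb (M v)) addrC; apply: le_trans (normvD _ _) _; rewrite lerD2l.
    apply: le_trans (Mtilt_dist _ _ vr (MP _ vr)) _.
    by rewrite ler_wpM2l // ltW.
  have P2 := dotv_le (v - w) (M v); have P3 := dotv_le (w - v) x.
  have := ler_wpM2l (normv_ge0 (v - w)) P1.
  move: (fM _ _ vr wr) P3; rewrite (normvBC w) !dotvDl !dotvNl.
  move: P2; rewrite dotvDl dotvNl; lra.
have {}vmin w : normv w <= rho / 2 -> f v - dotv v x <= f w - dotv w x.
  by move=> wr; apply: vmin; rewrite subr0.
move: vr (half _ vr); rewrite subr0 => vr2 vr.
have v0 := normv_ge0 v.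
(* Testing the maximum defining [f v] at [xb + tau *: v] shows that [f] exceeds [f 0] by at least
   [tau * normv v ^+ 2 / 2]. Comparison with [w = 0] then bounds [normv v] through
   [normv (x - xb)]. *)
have vint : normv v < rho / 2.
  have ray (t : R) : 0 <= t <= 1 -> normv (xb + t *: (tau *: v) - xb) < r.
    move=> /andP[t0 t1]; rewrite addrAC subrr add0r !normvZ !ger0_norm // ?(ltW tau0) //.
    have P1 := ler_piMl (mulr_ge0 (ltW tau0) v0) t1.
    have P2 : tau * normv v < tau * rho by rewrite ltr_pM2l.
    have mr : m <= r by rewrite ge_min lexx.
    lra.
  have [t t01 tE] := gradient_mean_value phi g xb (tau *: v) (fun t t01 => grad _ (ray t t01)).
  have xbr : normv (xb - xb) < r by rewrite subrr normv0.
  have := lip _ _ (ray t t01) xbr.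
  rewrite tilt_gradient0 subr0 addrAC subrr add0r normvZ ger0_norm ?(andP t01).1 // => P1.
  have tv : normv (tau *: v) = tau * normv v by rewrite normvZ gtr0_norm.
  have P2 : phi (xb + tau *: v) - phi xb <= L * (tau * normv v) ^+ 2.
    rewrite tE; apply: le_trans (dotv_le _ _) _; rewrite tv in P1 *.
    rewrite expr2 [leRHS]mulrA ler_wpM2r //; first by rewrite mulr_ge0 // ltW.
    apply: le_trans P1 _; rewrite ler_wpM2l //; apply: ler_piMl; last by case/andP: t01.
    by rewrite mulr_ge0 // ltW.
  have P3 : normv (xb + tau *: v - xb) <= gamma.
    rewrite addrAC subrr add0r tv.
    have : tau * normv v < tau * rho by rewrite ltr_pM2l.
    have mg : m <= gamma by rewrite ge_min lexx orbT.
    lra.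
  have := (MP _ vr).2 _ P3.
  have M0 : M 0 = xb by apply/Mtilt0/MP.
  have := vmin 0; rewrite normv0 => /(_ ltac:(lra)).
  rewrite /f M0 !dotv0l dotvDr dotvZr -sqr_normv => P4 P5.
  have P6 := dotv_le v (x - xb); rewrite dotvDr dotvNr in P6.
  have P7 : tau * normv v ^+ 2 - L * (tau * normv v) ^+ 2 <= normv v * normv (x - xb) by lra.
  have P8 : tau * normv v ^+ 2 / 2 <= tau * normv v ^+ 2 - L * (tau * normv v) ^+ 2.
    have : 0 <= tau * normv v ^+ 2 by rewrite mulr_ge0 ?sqr_ge0 // ltW.
    have : L * tau <= 1 / 2 by lra.
    nra.
  rewrite ltNge; apply/negP => vge.
  have v_gt0 : 0 < normv v by lra.
  have : normv v * (tau * normv v / 2) <= normv v * normv (x - xb) by lra.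
  rewrite ler_pM2l //; have := ler_wpM2l (ltW tau0) vge; lra.
exists v => //; suff -> : x = M v by exact: MP.
apply/subr0_eq/normv_eq0/eqP; rewrite eq_le normv_ge0 andbT.
(* Moving the tilt from [v] to [v + t *: e], minimality and the subgradient inequality give
   [dotv e x <= dotv e (M (v + t *: e))]; the Lipschitz bound on [M] yields [normv e ^+ 2 <= t *
   (kappa * normv e ^+ 2)]. *)
set e := x - M v; have e0 := normv_ge0 e.
have [->|/eqP/normv_gt0 e_gt0] := eqVneq e 0; first by rewrite normv0.
rewrite -(ler_pM2r e_gt0) mul0r.
have t00 : 0 < (rho / 2 - normv v) / normv e by rewrite divr_gt0 // subr_gt0.
apply: (le_of_small _ _ (kappa * normv e ^+ 2) _ t00) => t /andP[t0].
rewrite ler_pdivlMr // => te.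
have tE : normv (t *: e) = t * normv e by rewrite normvZ gtr0_norm.
have ver : normv (v + t *: e) <= rho / 2.
  by apply: le_trans (normvD _ _) _; rewrite tE; lra.
have ver' : normv (v + t *: e) < rho by lra.
have := fM _ _ ver' vr; have := vmin _ ver.
rewrite (_ : v + t *: e - v = t *: e); last by rewrite addrAC subrr add0r.
rewrite dotvDl !dotvZl => P1 P2.
have P3 : normv (M (v + t *: e) - M v) <= kappa * (t * normv e).
  have := Mtilt_lip _ _ _ _ ver' vr (MP _ ver') (MP _ vr).
  by rewrite [v + _ - _]addrAC subrr add0r tE.
have P4 := le_trans (dotv_le e _) (ler_wpM2l e0 P3).
have P5 : dotv e x <= dotv e (M (v + t *: e)) by rewrite -(ler_pM2l t0); lra.
have P6 : normv e ^+ 2 = dotv e x - dotv e (M v).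
  by rewrite sqr_normv {2}/e dotvDr dotvNr.
move: P4; rewrite dotvDr dotvNr; lra.
Qed.

(** Near [xb] each point solves the problem tilted by its own gradient, so quadratic growth holds
    from [x] to [y] and from [y] to [x]; adding the two cancels the values of [phi]. *)
Lemma tilt_strongly_monotone : exists2 rc, 0 < rc &
  forall x y, normv (x - xb) < rc -> normv (y - xb) < rc ->
    (2 * kappa)^-1 * normv (x - y) ^+ 2 <= dotv (g x - g y) (x - y).
Proof.
have r1 := r0; have L1 := L0; have g1 := gamma0; have rh := rho0; have ka := kappa0.
have [d d0 dP] := tilt_surjective.
have L20 : 0 < 2 * (L + 1) by lra.
(* The last two radii keep [g x] and the shifted tilt of [tilt_growth] within radius [rho]. *)
pose rc := Num.min d (Num.min (Num.min r gamma)
  (Num.min (rho / (2 * (L + 1))) (rho * kappa / 4))).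
exists rc.
  by rewrite !lt_min d0 r1 g1 divr_gt0 //= divr_gt0 // mulr_gt0.
have rcP x : normv (x - xb) < rc -> [/\ normv (x - xb) < r, normv (x - xb) < gamma,
    normv (g x) < rho / 2, normv (x - xb) < rho * kappa / 4 & Mtilt phi xb gamma (g x) x].
  rewrite !lt_min => /and3P[xd /andP[xr xg] /andP[]]; rewrite ltr_pdivlMr // => xL xk.
  split=> //.
    have xbr : normv (xb - xb) < r by rewrite subrr normv0.
    have := lip _ _ xr xbr; rewrite tilt_gradient0 subr0.
    have := normv_ge0 (x - xb); lra.
  by have [v vr vx] := dP _ xd; rewrite (Mtilt_gradient _ _ xr xg vx).
have growth x y : normv (x - xb) < rc -> normv (y - xb) < rc ->
    phi x + dotv (g x) (y - x) + (4 * kappa)^-1 * normv (y - x) ^+ 2 <= phi y.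
  move=> /rcP[xr xg gx xk xM] /rcP[yr yg _ yk _].
  apply: tilt_growth => //; [lra| |exact: ltW].
  apply: le_lt_trans (normvD _ _) _; rewrite normvZ gtr0_norm ?invr_gt0 ?mulr_gt0 //.
  have : normv (y - x) < rho * kappa / 2.
    rewrite -(subrKA xb) ; apply: le_lt_trans (normvD _ _) _; rewrite (normvBC xb); lra.
  move=> yx; have : (2 * kappa)^-1 * normv (y - x) < rho / 2.
    by rewrite mulrC ltr_pdivrMr ?mulr_gt0 //; have := mulr_gt0 rh ka; lra.
  lra.
move=> x y xr yr; have := growth _ _ xr yr; have := growth _ _ yr xr.
rewrite (normvBC y x).
have -> : (2 * kappa)^-1 * normv (x - y) ^+ 2 = 2 * ((4 * kappa)^-1 * normv (x - y) ^+ 2).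
  by field; rewrite gt_eqF.
rewrite !dotvDl !dotvDr !dotvNl !dotvNr; lra.
Qed.

End TiltStability.

(** * Convergence of the algorithm *)

Lemma geometric_cvg {R : realType} (e C : R) : 0 < e ->
  exists N : nat, forall k, (N <= k)%N -> C * (1 / 2) ^+ k < e.
Proof.
move=> e0; have [N NP] := archi_inv (e / (`|C| + 1)) ltac:(by rewrite divr_gt0 // ltr_wpDl).
exists N => k /NP; rewrite ltr_pdivlMr ?ltr_wpDl // => kN.
have h : (1 / 2 : R) ^+ k <= k.+1%:R^-1.
  rewrite expr_div_n expr1n mul1r lef_pV2 ?posrE ?exprn_gt0 ?ltr0n //.
  by rewrite -natrX ler_nat ltn_expl.
have p0 : 0 <= (1 / 2 : R) ^+ k by rewrite exprn_ge0 // divr_ge0.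
have := ler_wpM2r p0 (ler_norm C); have := ler_wpM2l (normr_ge0 C) h.
have : 0 <= (k.+1%:R^-1 : R) by rewrite invr_ge0.
move: (k.+1%:R^-1) kN => z; lra.
Qed.

Theorem theorem4p3 (R : realType) (n : nat) (phi : 'rV[R]_n -> R)
  (g : 'rV[R]_n -> 'rV[R]_n) (xb : 'rV[R]_n) (kappa : R) :
  0 < kappa ->
  C11_near phi g xb ->
  tilt_stable phi xb kappa ->
  semismooth_star g xb ->
  exists delta : R, 0 < delta /\
    (* well-definedness: every run started in B_delta(xb) that has not
       stopped can be continued *)
    (forall (x : nat -> 'rV[R]_n) (k : nat),
       normv (x 0%N - xb) <= delta -> algA_run g x k -> g (x k) <> 0 ->
       exists d, Upsilon_star g (x k) d) /\
    (* every infinite run started in B_delta(xb) converges Q-superlinearly *)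
    (forall x : nat -> 'rV[R]_n,
       normv (x 0%N - xb) <= delta -> (forall k, algA_run g x k) ->
       (forall k, g (x k) <> 0) ->
       cvgv x xb /\
       (forall e : R, 0 < e -> exists N : nat, forall k, (N <= k)%N ->
          normv (x k.+1 - xb) <= e * normv (x k - xb))).
Proof.
move=> kappa0 [r [L [r0 [L0 [grad lip]]]]]
  [gamma [gamma0 [Mtilt0 [rho [rho0 [Mtilt_ex Mtilt_lip]]]]]] ss.
have Mex v : normv v < rho -> exists x, Mtilt phi xb gamma v x.
  by move=> /Mtilt_ex[x [vx _]]; exists x.
have gxb := tilt_gradient0 _ _ _ _ _ r0 gamma0 grad Mtilt0.
have [rc rc0 mono] := tilt_strongly_monotone _ _ _ _ _ _ _ _
  r0 L0 kappa0 gamma0 rho0 grad lip Mtilt0 Mex Mtilt_lip.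
have c0 : 0 < (2 * kappa)^-1 by rewrite invr_gt0 mulr_gt0.
have step e (e0 : 0 < e) := newton_step _ _ _ _ _ r0 L0 gxb grad lip ss _ _ _ c0 rc0 e0 mono.
have half0 : 0 < (1 / 2 : R) by rewrite divr_gt0.
(* The factor 1/2 first gives linear contraction, which keeps all iterates in the starting ball. *)
have [d d0 dP] := step _ half0.
pose m := Num.min d (Num.min r rc).
have m0 : 0 < m by rewrite !lt_min d0 r0.
have decay (x : nat -> 'rV[R]_n) k : normv (x 0%N - xb) <= m / 2 -> algA_run g x k ->
    normv (x k - xb) <= m / 2 * (1 / 2) ^+ k.
  move=> x0; elim: k => [|k ih] run; first by rewrite expr0 mulr1.
  have {ih} xk := ih (fun j jk => run j (ltnW jk)).
  have k1 : (1 / 2 : R) ^+ k <= 1 by rewrite exprn_ile1 //; lra.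
  have md : m <= d by rewrite ge_min lexx.
  have := dP (x k) (x k - x k.+1) _ (run k (ltnSn k)).2.
  rewrite subKr exprS => /(_ _)/le_trans; apply.
    by apply: le_lt_trans xk _; nra.
  lra.
exists (m / 2); split; first by rewrite divr_gt0.
split=> [x k x0 run gk|x x0 run gk].
  have xm : normv (x k - xb) <= m / 2.
    apply: le_trans (decay _ _ x0 run) _; rewrite ler_piMr ?divr_ge0 ?(ltW m0) //.
    by rewrite exprn_ile1 //; lra.
  have mr : m <= r by rewrite !ge_min lexx orbT.
  have mrc : m <= rc by rewrite !ge_min lexx !orbT.
  (* Iterates lie within [m / 2] of [xb], so balls of radius [m / 3] around them stay where [g] is
     Lipschitz and strongly monotone. *)
  have near y : normv (y - x k) <= m / 3 -> normv (y - xb) < m.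
    by move=> yx; rewrite -(subrKA (x k)); apply: le_lt_trans (normvD _ _) _; lra.
  have m3 : 0 < m / 3 by rewrite divr_gt0.
  have xx : normv (x k - x k) <= m / 3 by rewrite subrr normv0 ltW.
  have [y z /near yr /near zr|y /near yr|w wP] :=
    @coderiv_surjective R n g (x k) (- g (x k)) (m / 3) L _ m3 L0 c0.
  - by apply: lip; lra.
  - by apply: mono; [lra|have := near _ xx; lra].
  by exists (- w); rewrite /Upsilon_star opprK.
have x_cvg : cvgv x xb.
  move=> e /(geometric_cvg _ (m / 2))[N NP]; exists N => k /NP.
  exact: le_lt_trans (decay _ _ x0 (run k)).
(* Once the iterates have entered the ball where the step estimate holds with factor [e], that
   estimate is the superlinear bound. *)
split=> // e e0; have [d' d'0 d'P] := step _ e0; have [N NP] := x_cvg _ d'0.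
exists N => k /NP xk; have := d'P _ _ xk (run k.+1 k (ltnSn k)).2.
by rewrite subKr.
Qed.
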